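(* Let $n\geq 3$ and let $B_n\in\Omega_n$ be a polyomino chain with $n$ squares. Let $$\Theta_1=2\theta_{2,3}-6\theta_{3,3}+4\theta_{3,4},\quad \Theta_2=\theta_{2,4}-\theta_{2,3}+\theta_{3,3}-\theta_{3,4},\quad \Theta_3=2\theta_{2,4}-2\theta_{2,3}+3\theta_{3,3}-4\theta_{3,4}+\theta_{4,4}.$$ (1) If $\Theta_1$, $\Theta_1+2\Theta_2$ and $\Theta_1+2\Theta_3$ are all positive, then $$TI(L_n)\leq TI(B_n)\leq TI(Z_n).$$ The right (respectively left) equality holds if and only if $B_n\cong Z_n$ (respectively $B_n\cong L_n$). (2) If $\Theta_1$, $\Theta_1+2\Theta_2$ and $\Theta_1+2\Theta_3$ are all negative, then $$TI(Z_n)\leq TI(B_n)\leq TI(L_n).$$ The right (respectively left) equality holds if and only if $B_n\cong L_n$ (respectively $B_n\cong Z_n$).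
   Context: A polyomino system is a finite 2-connected plane graph in which each interior face is a regular (unit) square of side length one. Two squares are adjacent if they share an edge. A polyomino chain is a polyomino system in which every square is adjacent to at most two squares; its squares form a sequence $C_1,\dots,C_n$ in which exactly consecutive squares are adjacent. A square adjacent to only one other square is terminal; a square adjacent to two other squares is non-terminal. A kink is a non-terminal square having a vertex of degree 2 (degrees are taken in the graph of the chain). The linear chain $L_n$ is the polyomino chain with $n$ squares without kinks. The zigzag chain $Z_n$ is the polyomino chain with $n$ squares consisting only of kinks and terminal squares. A segment is a maximal linear chain in a polyomino chain, including the kinks and/or terminal squares at its ends; its length is its number of squares. The segments of a chain are listed in order along the chain as $S_1,\dots,S_s$, consecutive ones sharing exactly one square (a kink); $S_1,S_s$ are external, and $S_i$ with $2\le i\le s-1$ are internal. $\Omega_n$ denotes the collection of all polyomino chains with $n$ squares in which no internal segment of length three has an edge connecting two vertices of degree three. Bond incident degree (BID) index: given a symmetric non-negative real valued function $f$, with $\theta_{a,b}=f(a,b)$, put $TI(G)=\sum_{uv\in E(G)}f(d_u,d_v)=\sum_{1\le a\le b\le\Delta(G)}x_{a,b}(G)\,\theta_{a,b}$, where $d_u$ is the degree of the vertex $u$, $\Delta(G)$ is the maximum degree, and $x_{a,b}(G)$ is the number of edges of $G$ connecting a vertex of degree $a$ with a vertex of degree $b$. *)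

(* Defs.v *)
From HB Require Import structures.
From mathcomp Require Import all_boot all_order all_algebra.
From mathcomp Require Import finmap reals.

Set Implicit Arguments.
Unset Strict Implicit.
Unset Printing Implicit Defensive.

Import Order.TTheory GRing.Theory Num.Theory.

Local Open Scope fset_scope.
Local Open Scope ring_scope.

(* The unit squares of a polyomino system are glued along entire edges, so up to
   an isometry the system is drawn on the square lattice: its vertices are points
   of Z^2 and its edges are unit lattice segments. *)
Definition point := (int * int)%type.

(* (p, false) is the segment from p to p + (1, 0);
   (p, true)  is the segment from p to p + (0, 1). *)
Definition segm := (point * bool)%type.

Definition src (e : segm) : point := e.1.
Definition tgt (e : segm) : point :=
  if e.2 then (e.1.1, e.1.2 + 1) else (e.1.1 + 1, e.1.2).

(* A finite plane graph on the lattice without isolated vertices is determined by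
   its edges. *)
Definition lgraph := {fset segm}.

Definition vertices (G : lgraph) : {fset point} :=
  [fset src e | e in G] `|` [fset tgt e | e in G].

Definition adj (G : lgraph) : rel point := fun u v =>
  has (fun e => ((src e, tgt e) == (u, v)) || ((src e, tgt e) == (v, u))) G.

Definition deg (G : lgraph) (v : point) : nat :=
  #|` [fset e in G | (src e == v) || (tgt e == v)]|.

Definition connected_off (G : lgraph) (X : {fset point}) : Prop :=
  forall u v, u \in vertices G `\` X -> v \in vertices G `\` X ->
  exists p : seq point,
    [/\ path (adj G) u p, last u p = v & all (fun w => w \notin X) p].

Definition two_connected (G : lgraph) : Prop :=
  (2 < #|` vertices G|)%N /\
  forall X : {fset point}, (#|` X| < 2)%N -> connected_off G X.

(* A cell of the lattice is denoted by its lower left corner. *)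
Definition cell := point.

Definition sides (c : cell) : seq segm :=
  [:: (c, false); ((c.1, c.2 + 1), false); (c, true); ((c.1 + 1, c.2), true)].

Definition corners (c : cell) : seq point :=
  [:: c; (c.1 + 1, c.2); (c.1, c.2 + 1); (c.1 + 1, c.2 + 1)].

(* Faces are the connected components of the complement of the drawing.  Each
   face of a graph drawn on the lattice is the union of the open cells in a class
   of same_face, of the lattice edges crossed between them, and of lattice points
   that are not vertices of the graph. *)
Definition cross (G : lgraph) : rel cell := fun c d =>
  has (fun e => (e \notin G) && (e \in sides d)) (sides c).

Definition same_face (G : lgraph) (c d : cell) : Prop :=
  exists p : seq cell, path (cross G) c p /\ last c p = d.

Definition in_interior_face (G : lgraph) (c : cell) : Prop :=
  exists s : seq cell, forall d, same_face G c d -> d \in s.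

(* A cell is a face by itself exactly when its four sides are edges. *)
Definition square (G : lgraph) (c : cell) : bool :=
  all (fun e => e \in G) (sides c).

Definition polyomino_system (G : lgraph) : Prop :=
  two_connected G /\ forall c, in_interior_face G c -> square G c.

Definition adjacent (c d : cell) : bool :=
  (c != d) && has (fun e => e \in sides d) (sides c).

Definition num_adjacent (C : seq cell) (c : cell) : nat := count (adjacent c) C.

Record polyomino_chain (n : nat) := PolyominoChain {
  graph :> lgraph;
  squares : seq cell;
  graph_system : polyomino_system graph;
  squares_uniq : uniq squares;
  squaresE : forall c, (c \in squares) = square graph c;
  size_squares : size squares = n;
  squares_le2 : all (fun c => num_adjacent squares c <= 2)%N squares;
  squares_adjacent : forall i j, (i < n)%N -> (j < n)%N ->
    adjacent (nth (0, 0) squares i) (nth (0, 0) squares j) =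
    ((i.+1 == j) || (j.+1 == i))
}.

Definition terminal (C : seq cell) (c : cell) : bool :=
  (c \in C) && (num_adjacent C c == 1)%N.

Definition nonterminal (C : seq cell) (c : cell) : bool :=
  (c \in C) && (num_adjacent C c == 2)%N.

Definition kink (G : lgraph) (C : seq cell) (c : cell) : bool :=
  nonterminal C c && has (fun v => deg G v == 2)%N (corners c).

Definition kinkless (G : lgraph) (C : seq cell) : bool :=
  all (fun c => ~~ kink G C c) C.

Definition is_linear_chain n (B : polyomino_chain n) : Prop :=
  kinkless B (squares B).

Definition is_zigzag_chain n (B : polyomino_chain n) : Prop :=
  all (fun c => kink B (squares B) c || terminal (squares B) c) (squares B).

(* The part of a chain between its squares number i and j (counted from 0), both
   included; it is again a polyomino chain, with graph cells_graph (run C i j). *)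
Definition run (C : seq cell) (i j : nat) : seq cell := take (j - i).+1 (drop i C).

Definition cells_graph (s : seq cell) : lgraph :=
  [fset e in flatten [seq sides c | c <- s]].

Definition linear_run (C : seq cell) (i j : nat) : bool :=
  [&& i <= j, j < size C & kinkless (cells_graph (run C i j)) (run C i j)]%N.

Definition segment (C : seq cell) (i j : nat) : Prop :=
  linear_run C i j /\
  forall i' j', (i' <= i)%N -> (j <= j')%N -> linear_run C i' j' ->
    i' = i /\ j' = j.

(* Neither the first nor the last segment along the chain. *)
Definition internal_segment (C : seq cell) (i j : nat) : Prop :=
  [/\ segment C i j,
      exists i' j', segment C i' j' /\ (i' < i)%N &
      exists i' j', segment C i' j' /\ (i < i')%N].

Definition Omega n (B : polyomino_chain n) : Prop :=
  forall i j, internal_segment (squares B) i j ->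
    size (run (squares B) i j) = 3%N ->
    forall e, e \in cells_graph (run (squares B) i j) ->
      ~ (deg B (src e) = 3%N /\ deg B (tgt e) = 3%N).

Definition graph_iso (G H : lgraph) : Prop :=
  exists phi : point -> point,
    [/\ {in vertices G &, injective phi},
        [fset phi v | v in vertices G] = vertices H &
        {in vertices G &, forall u v, adj H (phi u) (phi v) = adj G u v}].

(* Independent of the orientation of the edges when f is symmetric. *)
Definition TI (R : realType) (f : nat -> nat -> R) (G : lgraph) : R :=
  \sum_(e <- G) f (deg G (src e)) (deg G (tgt e)).

Definition Theta1 (R : realType) (f : nat -> nat -> R) : R :=
  2 * f 2 3 - 6 * f 3 3 + 4 * f 3 4.

Definition Theta2 (R : realType) (f : nat -> nat -> R) : R :=
  f 2 4 - f 2 3 + f 3 3 - f 3 4.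

Definition Theta3 (R : realType) (f : nat -> nat -> R) : R :=
  2 * f 2 4 - 2 * f 2 3 + 3 * f 3 3 - 4 * f 3 4 + f 4 4.

(* Main.v *)
Require Import Defs.
From HB Require Import structures.
From mathcomp Require Import all_boot all_order all_algebra.
From mathcomp Require Import finmap boolp reals zify lra.

Set Implicit Arguments.
Unset Strict Implicit.
Unset Printing Implicit Defensive.

Import Order.TTheory GRing.Theory Num.Theory.

Local Open Scope ring_scope.

(** Call a square of a chain T if it is terminal, K if it is a kink and S
    otherwise.  For a chain of Omega the index is a sum, over the pairs of
    consecutive squares, of a number which depends only on the types of the two
    squares ([TI_cells_graph], [joint_weight]).  With theta_ab = f a b these
    numbers are

      SS : 3 theta_33                  SK : 2 theta_34 + theta_23
      KK : 2 theta_24 + theta_44       TS : theta_22 + 2 theta_23 + 2 theta_33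
      TK : theta_22 + 2 theta_23 + theta_24 + theta_34

    so that SK - SS = Theta1 / 2, KK - SK = Theta1 / 2 + Theta3 and
    TK - TS = Theta1 / 2 + Theta2.  If the three numbers in the hypothesis are
    positive, each summand therefore increases strictly whenever an S of the
    pair is replaced by a K ([joint_weight_min], [joint_weight_max]).  The ends
    are of type T in all chains, hence the sum is least when there is no K,
    greatest when there is no S, and equality forces all the squares to be of
    the extremal kind.  The second half of the theorem is the first one for -f.

    The formula is local.  A vertex which lies in k squares has degree k + 1
    ([deg_cells_graph]), and two squares with a common vertex are at most two
    steps apart, so that the degrees at the corners of a square are determined
    by a window of at most five squares.  Up to translation there are finitely
    many windows, and the contribution of the central square is checked on each
    of them.  Only one pattern fails to be determined by the types: two kinks
    around a straight square may turn to the same side or to opposite sides.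
    Turning to the same side produces an edge with both ends of degree 3 in an
    internal segment of length 3, which is what Omega forbids
    ([Omega_no_same_side]).

    Locality rests on planarity: a chain could bend back and touch itself in a
    single point, or have edges outside its squares.  Both would leave two cells
    of the exterior face which are separated by a cycle of the graph.  This is
    excluded by a discrete form of the Jordan curve theorem, namely that a closed
    walk through the cells crosses each closed walk along the edges an even
    number of times ([winding_edge], [edge_in_square], [no_pinch]).

    Finally the index is invariant under isomorphism ([TI_iso]), and chains of
    the same length without K, or without S, are congruent: the directions of
    their steps are constant, respectively alternate between two perpendicular
    ones ([straight_iso], [zigzag_iso]). *)

(** * Winding parity of walks through the cells *)

(** Integer comparisons are decided one at a time and the inconsistent branches
    are pruned at once: a single call of [lia] on exclusive disjunctions of many
    comparisons is exponential. *)
Ltac decide_atoms :=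
  repeat ((let h := fresh in case: eqP => h //=; try (exfalso; lia)) ||
          (let h := fresh in case: lerP => h //=; try (exfalso; lia))).

Definition crosses (e : segm) (c d : cell) : bool :=
  [&& c != d, e \in sides c & e \in sides d].

Lemma mem_sides (e : segm) (c : cell) : (e \in sides c) =
  (if e.2 then (e.1.2 == c.2) && ((e.1.1 == c.1) || (e.1.1 == c.1 + 1))
   else (e.1.1 == c.1) && ((e.1.2 == c.2) || (e.1.2 == c.2 + 1))).
Proof.
case: e => [[x y] b]; case: c => a z; rewrite /sides !inE !xpair_eqE /=.
by case: b; lia.
Qed.

Lemma mem_corners (v : point) (c : cell) : (v \in corners c) =
  ((v.1 == c.1) || (v.1 == c.1 + 1)) && ((v.2 == c.2) || (v.2 == c.2 + 1)).
Proof.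
case: v => x y; case: c => a b; rewrite /corners !inE !xpair_eqE /=; lia.
Qed.

Lemma adjacentE (c d : cell) : adjacent c d =
  ((c.1 == d.1) && ((c.2 + 1 == d.2) || (d.2 + 1 == c.2))) ||
  ((c.2 == d.2) && ((c.1 + 1 == d.1) || (d.1 + 1 == c.1))).
Proof.
case: c => a b; case: d => x y; rewrite /adjacent /= !mem_sides /= xpair_eqE.
lia.
Qed.

Lemma crosses_uniq e e' c d : crosses e c d -> crosses e' c d -> e = e'.
Proof.
case: e => [[x y] []]; case: e' => [[x' y'] []]; case: c => a b; case: d => a' b';
rewrite /crosses !mem_sides xpair_eqE /= => h1 h2; try lia; congr (_, _, _); lia.
Qed.

Fixpoint cross_parity (e : segm) (c : cell) (p : seq cell) : bool :=
  if p is d :: p' then crosses e c d (+) cross_parity e d p' else false.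

Lemma cross_parity_cat e c p q :
  cross_parity e c (p ++ q) = cross_parity e c p (+) cross_parity e (last c p) q.
Proof. by elim: p c => //= d p IH c; rewrite IH addbA. Qed.

Definition dual_step : rel cell := fun c d => (c == d) || adjacent c d.

(** The step from [c] to [d] crosses the horizontal ray that issues from [v] to
    the right. *)
Definition ray_hit (v : point) (c d : cell) : bool :=
  [&& c.1 == d.1, v.1 <= c.1 &
   ((c.2 == v.2) && (d.2 + 1 == v.2)) || ((d.2 == v.2) && (c.2 + 1 == v.2))].

Fixpoint winding (v : point) (c : cell) (p : seq cell) : bool :=
  if p is d :: p' then ray_hit v c d (+) winding v d p' else false.

(** Counting the crossings with the rays at the two ends of an edge: if the edge
    is horizontal the rays differ by the edge itself.  If it is vertical, the rays
    and the edge bound the cells to the right of the edge in one row, and a closed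
    walk enters and leaves this half-row equally often. *)
Lemma winding_edge (e : segm) (c : cell) (p : seq cell) :
  path dual_step c p -> last c p = c ->
  winding (src e) c p (+) winding (tgt e) c p = cross_parity e c p.
Proof.
case: e => [[x y] b] hp hl.
(* The half-row to the right of a vertical edge; empty for a horizontal one. *)
pose r (d : cell) := [&& b, d.2 == y & x <= d.1].
suff h : winding (src (x, y, b)) c p (+) winding (tgt (x, y, b)) c p
   (+) cross_parity (x, y, b) c p = r c (+) r (last c p).
  by move: h; rewrite hl; case: (winding _ _ _); case: (winding _ _ _);
     case: (cross_parity _ _ _); case: (r c).
elim: p c hp {hl} => [|d p IH] c /=; first by rewrite addbb.
case/andP => hs /IH h.
have hstep : ray_hit (src (x, y, b)) c d (+) ray_hit (tgt (x, y, b)) c d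
   (+) crosses (x, y, b) c d = r c (+) r d.
  rewrite {h IH}; move: hs; rewrite /dual_step adjacentE.
  rewrite /crosses !mem_sides /ray_hit /r /src /tgt /=.
  case/orP=> [/eqP<-|].
    rewrite eqxx /= addbb; case: b {r} => /=; case: c => a1 a2; rewrite /=; decide_atoms.
  case: c => a1 a2; case: d => d1 d2; rewrite xpair_eqE /=.
  case/orP=> /andP[/eqP<- /orP[/eqP<-|/eqP<-]]; case: b {r} => /=; decide_atoms.
have -> : r c (+) r (last d p) = (r c (+) r d) (+) (r d (+) r (last d p)).
  by case: (r c); case: (r d); case: (r _).
rewrite -h -hstep; do 3 case: (winding _ _ _) => //;
  by do 2 case: (ray_hit _ _ _) => //; case: (crosses _ _ _) => //; case: (cross_parity _ _ _).
Qed.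

(** * Non-square cells lie in the exterior face *)

Lemma same_face_refl G c : same_face G c c.
Proof. by exists [::]. Qed.

Lemma same_face_trans G c d e : same_face G c d -> same_face G d e -> same_face G c e.
Proof.
move=> [p [hp hl]] [q [hq hm]]; exists (p ++ q).
by rewrite cat_path last_cat hp hl hq.
Qed.

Lemma cross_sym G : symmetric (cross G).
Proof.
by move=> c d; apply/hasP/hasP => -[e h1 /andP[h2 h3]]; exists e => //; rewrite h2.
Qed.

Lemma same_face_sym G c d : same_face G c d -> same_face G d c.
Proof.
move=> [p [hp <-]]; elim: p c hp => [|x p IH] c /=; first by move=> _; apply: same_face_refl.
case/andP=> hc /IH h; apply: (same_face_trans h); exists [:: c].
by rewrite /= cross_sym hc.
Qed.

Lemma cross_dual_step G c d : cross G c d -> dual_step c d.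
Proof.
case/hasP=> e h1 /andP[_ h2]; rewrite /dual_step /adjacent.
rewrite -implyNb; apply/implyP=> ->; apply/hasP; by exists e.
Qed.

Lemma cross_parity_cross G e c p :
  e \in G -> path (cross G) c p -> cross_parity e c p = false.
Proof.
move=> he; elim: p c => //= d p IH c /andP[hc /IH ->]; rewrite addbF.
apply/negP=> h; have /hasP[e'] := hc; move=> h1 /andP[h2 h3].
have h' : crosses e' c d by case/and3P: h => h _ _; rewrite /crosses h h1 h3.
by rewrite -(crosses_uniq h' h) (negbTE h2) in he.
Qed.

(** A walk inside a face closes up with [q] to a closed walk which meets the edges
    of [G] only along [q], so its winding parity is a potential on the vertices
    whose jumps along the edges of [G] are the crossings of [q]. *)
Lemma face_potential G c d q :
  same_face G c d -> path dual_step d q -> last d q = c ->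
  exists w : point -> bool, forall e, e \in G ->
    w (src e) (+) w (tgt e) = cross_parity e d q.
Proof.
move=> [p [hp hl]] hq hm; exists (fun v => winding v c (p ++ q)) => e he.
rewrite winding_edge ?last_cat ?hl // ?cross_parity_cat ?(cross_parity_cross he hp) ?hl //.
rewrite cat_path hl hq andbT; apply: sub_path hp; exact: cross_dual_step.
Qed.

Lemma edges_bounded (G : lgraph) :
  exists M : int, forall e : segm, e \in G -> `|e.1.1| <= M /\ `|e.1.2| <= M.
Proof.
rewrite -[_ G]/(mem (enum_fset G)).
elim: (enum_fset G) => [|e s [M hM]]; first by exists 0.
exists (`|M| + `|e.1.1 : int| + `|e.1.2 : int|) => e'; rewrite inE => /orP[/eqP->|/hM [] ].
  by move: (e.1.1 : int) (e.1.2 : int) => x y; lia.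
move: (e.1.1 : int) (e.1.2 : int) (e'.1.1 : int) (e'.1.2 : int) => x y x' y'; lia.
Qed.

(** A face which is not contained in a finite set of cells reaches the outside of
    a box that contains all the edges, and there one moves freely. *)
Lemma exterior_connected G c d :
  ~ in_interior_face G c -> ~ in_interior_face G d -> same_face G c d.
Proof.
have [M hM] := edges_bounded G.
pose far (c : cell) := (M + 1 < `|c.1|) || (M + 1 < `|c.2|).
have far_cross x y : far x -> adjacent x y -> cross G x y.
  move=> hx /andP[_ /hasP[e h1 h2]]; apply/hasP; exists e => //; rewrite h2 andbT.
  apply/negP=> /hM; move: h1 hx; rewrite mem_sides /far.
  case: e {h2} => [[e1 e2] []] /=; lia.
have row y : (forall x, far (x, y)) -> forall x x', same_face G (x, y) (x', y).
  move=> hf x x'; wlog hx : x x' / x <= x'.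
    by move=> h; case: (lerP x x') => hx; [exact: h|apply/same_face_sym/h/ltW].
  have -> : x' = x + `|x' - x|%N by lia.
  elim: `|x' - x|%N => [|n IH]; first by rewrite addr0; apply: same_face_refl.
  apply: (same_face_trans IH); exists [:: (x + n.+1, y)]; split=> //=; rewrite andbT.
  by apply: far_cross => //; rewrite adjacentE /=; lia.
have col x : (forall y, far (x, y)) -> forall y y', same_face G (x, y) (x, y').
  move=> hf y y'; wlog hx : y y' / y <= y'.
    by move=> h; case: (lerP y y') => hx; [exact: h|apply/same_face_sym/h/ltW].
  have -> : y' = y + `|y' - y|%N by lia.
  elim: `|y' - y|%N => [|n IH]; first by rewrite addr0; apply: same_face_refl.
  apply: (same_face_trans IH); exists [:: (x, y + n.+1)]; split=> //=; rewrite andbT.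
  by apply: far_cross => //; rewrite adjacentE /=; lia.
pose K : int := `|M| + 2.
have far_base c' : far c' -> same_face G c' (K, K).
  case: c' => x y; rewrite /far /= => /orP[] h.
    apply: (@same_face_trans _ _ (x, K)); first by apply: col => z; rewrite /far h.
    by apply: row => z; rewrite /far /K /=; lia.
  apply: (@same_face_trans _ _ (K, y)); first by apply: row => z; rewrite /far h orbT.
  by apply: col => z; rewrite /far /K /=; lia.
have ext_base c' : ~ in_interior_face G c' -> same_face G c' (K, K).
  pose r := [seq (Posz i) - K | i <- iota 0 (absz (K + K)).+1].
  move=> h; have : exists d', same_face G c' d' /\ far d'.
    apply: contrapT => h'; apply: h; exists [seq (x, y) | x <- r, y <- r] => -[x y] hd.
    have hf : ~~ far (x, y) by apply/negP => hf; apply: h'; exists (x, y).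
    have mr z : `|z| <= M + 1 -> z \in r.
      move=> hz; apply/mapP; exists (absz (z + K)); first by rewrite mem_iota /K; lia.
      by rewrite /K; lia.
    move: hf; rewrite /far negb_or -!leNgt => /andP[hx hy].
    by apply/allpairsP; exists (x, y); split=> //=; apply: mr.
  by case=> d' [h1 /far_base]; apply: same_face_trans.
by move=> /ext_base hc /ext_base /same_face_sym; apply: same_face_trans.
Qed.

Lemma nonsquares_same_face G c d : polyomino_system G ->
  ~~ square G c -> ~~ square G d -> same_face G c d.
Proof. by move=> [_ hsq] hc hd; apply: exterior_connected => /hsq; apply/negP. Qed.

Lemma path_constant (T : eqType) (e : rel T) (P : T -> bool) (w : T -> bool) u p :
  P u -> all P p -> path e u p ->
  (forall x y, P x -> P y -> e x y -> w x = w y) -> w u = w (last u p).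
Proof.
move=> hu hp he hw; elim: p u hu hp he => //= x p IH u hu /andP[hx hp] /andP[h1 h2].
by rewrite (hw u x) //; apply: IH.
Qed.

Lemma src_vertex (G : lgraph) e : e \in G -> src e \in vertices G.
Proof. by move=> he; rewrite in_fsetU in_imfset. Qed.

Lemma tgt_vertex (G : lgraph) e : e \in G -> tgt e \in vertices G.
Proof. by move=> he; rewrite in_fsetU orbC in_imfset. Qed.

Lemma adjP (G : lgraph) u v :
  reflect (exists2 e, e \in G & (src e = u /\ tgt e = v) \/ (src e = v /\ tgt e = u))
    (adj G u v).
Proof.
apply: (iffP hasP) => -[e he h]; exists e => //.
  by case/orP: h => /eqP[-> ->]; [left|right].
by case: h => -[-> ->]; rewrite eqxx ?orbT.
Qed.

Lemma src_tgt_neq e : src e != tgt e.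
Proof. by case: e => [[x y] []]; rewrite /src /tgt xpair_eqE /=; lia. Qed.

Lemma segm_eq e e' : src e = src e' -> tgt e = tgt e' -> e = e'.
Proof.
case: e => [[x y] b]; case: e' => [[x' y'] b']; rewrite /src /tgt => /= -[-> ->] /eqP.
by case: b; case: b' => //; rewrite xpair_eqE /=; lia.
Qed.

(** * A chain is the union of its squares and does not touch itself *)

(** The cell to the left of a vertical edge, or below a horizontal one.  The cell
    on the other side has the same lower left corner as the edge. *)
Definition side_cell (e : segm) : cell :=
  if e.2 then (e.1.1 - 1, e.1.2) else (e.1.1, e.1.2 - 1).

Lemma crosses_side_cell e e' : crosses e' (side_cell e) (src e) = (e' == e).
Proof.
have h : crosses e (side_cell e) (src e).
  case: e => [[x y] []]; rewrite /crosses /src /side_cell !mem_sides xpair_eqE /=; lia.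
apply/idP/eqP => [h'|-> //]; exact: crosses_uniq h' h.
Qed.

Lemma crosses_adjacent e c d : crosses e c d -> adjacent c d.
Proof. by case/and3P=> h1 h2 h3; rewrite /adjacent h1; apply/hasP; exists e. Qed.

Lemma constant_off_vertex G x (w : point -> bool) : two_connected G ->
  (forall e, e \in G -> src e != x -> tgt e != x -> w (src e) = w (tgt e)) ->
  {in vertices G &, forall u v, u != x -> v != x -> w u = w v}.
Proof.
move=> [_ hG] hw u v hu hv hux hvx.
have hX y : y \in vertices G -> y != x -> y \in (vertices G `\` [fset x])%fset.
  by move=> hy1 hy2; rewrite in_fsetD in_fset1 hy2.
have hc : (#|` [fset x]%fset| < 2)%N by rewrite cardfs1.
have [p [hp <- ha]] := hG _ hc u v (hX _ hu hux) (hX _ hv hvx).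
apply: (@path_constant _ (adj G) (fun y => y != x)) => //.
  by apply: sub_all ha => y; rewrite in_fset1.
move=> y z hy hz /adjP[e he [] [hs ht]].
  by rewrite -hs -ht; apply: hw; rewrite ?hs ?ht.
by rewrite -hs -ht; apply/esym/hw; rewrite ?hs ?ht.
Qed.

(** If the cells on both sides of an edge were in the exterior face, the potential
    would jump along this edge only.  Connectivity after the removal of either end
    equates the values at the two ends with the value at a third vertex. *)
Lemma edge_in_square G e : polyomino_system G -> e \in G ->
  square G (src e) || square G (side_cell e).
Proof.
move=> hP he; apply: contrapT => /negP; rewrite negb_or => /andP[h1 h2].
have hf := nonsquares_same_face hP h1 h2; have [hG _] := hP.
have hc := crosses_side_cell e; have hee := hc e; rewrite eqxx in hee.
have [||w hw] := face_potential (q := [:: src e]) hf => //.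
  by rewrite /= andbT /dual_step (crosses_adjacent hee) orbT.
have {}hw e' : e' \in G -> w (src e') (+) w (tgt e') = (e' == e).
  by move=> /hw ->; rewrite /= hc addbF.
have off x : x \in [:: src e; tgt e] ->
    {in vertices G &, forall u v, u != x -> v != x -> w u = w v}.
  move=> hx; apply: constant_off_vertex => // e' he' h3 h4.
  have : (e' == e) = false.
    by apply: contraTF hx => /eqP h; rewrite !inE -h negb_or !(eq_sym x) h3.
  by rewrite -hw //; case: (w _); case: (w _).
have [z] : exists z, z \in (vertices G `\` [fset src e; tgt e])%fset.
  apply/fset0Pn; rewrite -cardfs_gt0 cardfsD subn_gt0.
  apply: leq_ltn_trans hG.1; apply: leq_trans (fsubset_leq_card (fsubsetIr _ _)) _.
  by rewrite cardfs2; case: (_ != _).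
rewrite in_fsetD in_fset2 negb_or => /andP[/andP[hz1 hz2] hz].
have hst := src_tgt_neq e; have := hw e he; rewrite eqxx.
have <- : w z = w (src e).
  by apply: (off (tgt e)); rewrite ?in_cons ?eqxx ?orbT ?src_vertex.
have <- : w z = w (tgt e).
  by apply: (off (src e)); rewrite ?mem_head ?tgt_vertex // eq_sym.
by rewrite addbb.
Qed.

Lemma sides_in_graph G c e : square G c -> e \in sides c -> e \in G.
Proof. by move=> /allP; apply. Qed.

Definition joins (e : segm) (u v : point) : bool :=
  ((src e, tgt e) == (u, v)) || ((src e, tgt e) == (v, u)).

(** Around the point [p], the cell [c] lies between [a] and [b].  If [a] and [b]
    were exterior, the potential given by the detour [a], [c], [b] would jump along
    the edges [e1] and [e2] at [p] but not along [e3], although the other ends of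
    [e1] and [e3] are joined by a walk that avoids [p]. *)
Lemma no_pinch G (a b c : cell) (p u1 u2 u3 : point) (e1 e2 e3 : segm) :
  polyomino_system G -> crosses e1 a c -> crosses e2 c b ->
  joins e1 p u1 -> joins e2 p u2 -> joins e3 p u3 ->
  e1 != e2 -> e1 != e3 -> e2 != e3 -> e1 \in G -> e3 \in G ->
  square G a || square G b.
Proof.
move=> hP c1 c2 j1 j2 j3 n12 n13 n23 g1 g3.
apply: contrapT => /negP; rewrite negb_or => /andP[h1 h2].
have hf := nonsquares_same_face hP h2 h1; have [hG _] := hP.
have [||w hw] := face_potential (q := [:: c; b]) hf => //.
  by rewrite /= /dual_step (crosses_adjacent c1) (crosses_adjacent c2) !orbT.
have {}hw e u v : e \in G -> joins e u v -> w u (+) w v = (e == e1) (+) (e == e2).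
  move=> he j; transitivity (w (src e) (+) w (tgt e)).
    by case/orP: j => /eqP[-> ->] //; apply: addbC.
  rewrite hw // /cross_parity addbF; congr (_ (+) _).
    by apply/idP/eqP => [h|-> //]; apply: crosses_uniq h c1.
  by apply/idP/eqP => [h|-> //]; apply: crosses_uniq h c2.
have end_p e u : joins e p u -> (p == src e) || (p == tgt e).
  by case/orP=> /eqP[-> ->]; rewrite eqxx ?orbT.
have end_vertex e u : e \in G -> joins e p u -> u \in vertices G /\ u != p.
  move=> he j; have := src_tgt_neq e; have := src_vertex he; have := tgt_vertex he.
  by case/orP: j => /eqP[-> ->] hv1 hv2 hn; split; rewrite // 1?eq_sym.
have off : {in vertices G &, forall u v, u != p -> v != p -> w u = w v}.
  apply: constant_off_vertex => // e he h3 h4.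
  have hp : (p == src e) || (p == tgt e) = false by rewrite !(eq_sym p) (negbTE h3) (negbTE h4).
  have := hw e (src e) (tgt e) he; rewrite /joins eqxx => /(_ isT).
  have -> : (e == e1) = false by apply: contraFF hp => /eqP->; apply: end_p j1.
  have -> : (e == e2) = false by apply: contraFF hp => /eqP->; apply: end_p j2.
  by case: (w _); case: (w _).
have [v1 p1] := end_vertex _ _ g1 j1; have [v3 p3] := end_vertex _ _ g3 j3.
have := hw _ _ _ g1 j1; have := hw _ _ _ g3 j3.
rewrite (off _ _ v1 v3) // eqxx (negbTE n12) 2!(eq_sym e3) (negbTE n13) (negbTE n23).
by move=> ->.
Qed.

Lemma square_diag G x y : polyomino_system G ->
  square G (x, y) -> square G (x + 1, y + 1) ->
  square G (x + 1, y) || square G (x, y + 1).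
Proof.
move=> hG hc hd.
apply: (@no_pinch _ _ _ (x, y) (x + 1, y + 1) (x + 1, y) (x, y + 1) (x + 1, y + 1 + 1)
  ((x + 1, y), true) ((x, y + 1), false) ((x + 1, y + 1), true) hG);
  rewrite /crosses /joins /src /tgt ?mem_sides ?xpair_eqE //=; try lia.
- by apply: (sides_in_graph hc); rewrite mem_sides /=; lia.
- by apply: (sides_in_graph hd); rewrite mem_sides /=; lia.
Qed.

Lemma square_antidiag G x y : polyomino_system G ->
  square G (x, y) -> square G (x + 1, y - 1) ->
  square G (x + 1, y) || square G (x, y - 1).
Proof.
move=> hG hc hd.
apply: (@no_pinch _ _ _ (x, y) (x + 1, y) (x + 1, y + 1) (x, y) (x + 1 + 1, y)
  ((x + 1, y), true) ((x, y), false) ((x + 1, y), false) hG);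
  rewrite /crosses /joins /src /tgt ?mem_sides ?xpair_eqE //=; try lia.
- by apply: (sides_in_graph hc); rewrite mem_sides /=; lia.
- by apply: (sides_in_graph hd); rewrite mem_sides /=; lia.
Qed.

Notation "s `_[ i ]" := (nth ((0, 0) : cell) s i) (at level 3, i at level 200,
  left associativity, format "s `_[ i ]").

(** What the degrees depend on, separated from planarity: unlike a polyomino
    chain, this notion passes to sublists of consecutive squares at once, as the
    study of segments requires. *)
Record cell_chain (s : seq cell) : Prop := CellChain {
  cell_chain_uniq : uniq s;
  cell_chain_adjacent : forall i j, (i < size s)%N -> (j < size s)%N ->
    adjacent s`_[i] s`_[j] = (i.+1 == j) || (j.+1 == i);
  cell_chain_corner : forall i j v, (i < size s)%N -> (j < size s)%N ->
    v \in corners s`_[i] -> v \in corners s`_[j] -> (j <= i.+2)%N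
}.

Lemma mem_cells_graph s e :
  (e \in cells_graph s) = (src e \in s) || (side_cell e \in s).
Proof.
rewrite /cells_graph in_fset /=; apply/flatten_mapP/orP.
  case=> c hc; rewrite mem_sides => h.
  suff: (c == src e) || (c == side_cell e) by case/orP=> /eqP<-; [left|right].
  case: e c h {hc} => [[x y] []] [a b]; rewrite /src /side_cell !xpair_eqE /=; lia.
case=> h; [exists (src e)|exists (side_cell e)] => //;
by case: e {h} => [[x y] []]; rewrite mem_sides /src /side_cell /=; lia.
Qed.

Lemma corner_cases (c d : cell) v : v \in corners c -> v \in corners d ->
  [\/ c = d, adjacent c d,
    d = (c.1 + 1, c.2 + 1) \/ c = (d.1 + 1, d.2 + 1) |
    d = (c.1 + 1, c.2 - 1) \/ c = (d.1 + 1, d.2 - 1)].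
Proof.
case: c => a b; case: d => x y; case: v => v w; rewrite !mem_corners adjacentE /=.
move=> h1 h2.
have h : (a == x) && (b == y) ||
  ((a == x) && ((b + 1 == y) || (y + 1 == b)) || (b == y) && ((a + 1 == x) || (x + 1 == a))) ||
  (((x == a + 1) && (y == b + 1)) || ((a == x + 1) && (b == y + 1))) ||
  (((x == a + 1) && (y == b - 1)) || ((a == x + 1) && (b == y - 1))).
  by move: h2; case/andP: h1 => /orP[/eqP->|/eqP->] /orP[/eqP->|/eqP->]; lia.
case/orP: h => [/orP[/orP[/andP[/eqP-> /eqP->]|->]|]|].
- by constructor 1.
- by constructor 2.
- by case/orP=> /andP[/eqP-> /eqP->]; constructor 3; [left|right].
- by case/orP=> /andP[/eqP-> /eqP->]; constructor 4; [left|right].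
Qed.

(** Two squares with just a corner in common have a common neighbour by planarity,
    and the neighbours of a square are the previous one and the next one. *)
Lemma squares_cell_chain n (B : polyomino_chain n) : cell_chain (squares B).
Proof.
have hadj : forall i j, (i < size (squares B))%N -> (j < size (squares B))%N ->
    adjacent (squares B)`_[i] (squares B)`_[j] = (i.+1 == j) || (j.+1 == i).
  by move=> i j; rewrite size_squares => hi hj; apply: squares_adjacent.
split=> //; first exact: squares_uniq.
move=> i j v hi hj hvi hvj.
have sq k : (k < size (squares B))%N -> square B (squares B)`_[k].
  by move=> hk; rewrite -squaresE mem_nth.
have common c : square B c -> adjacent (squares B)`_[i] c -> adjacent c (squares B)`_[j] ->
    (j <= i.+2)%N.
  rewrite -squaresE => /(nthP (0, 0))[k hk <-]; rewrite !hadj //; lia.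
have hs := graph_system B.
have := sq _ hi; have := sq _ hj; move: common (corner_cases hvi hvj) (hadj i j hi hj).
have := nth_uniq (0, 0) hi hj (squares_uniq B).
case: ((squares B)`_[i]) => a b; case: ((squares B)`_[j]) => x y /=.
move=> hu common [].
- by move=> e; rewrite e eqxx in hu; lia.
- by move=> -> /esym; lia.
- case=> -[ex ey] _ h1 h2; subst.
    have /orP[] := square_diag hs h2 h1 => h; apply: (common _ h); rewrite adjacentE /=; lia.
  have /orP[] := square_diag hs h1 h2 => h; apply: (common _ h); rewrite adjacentE /=; lia.
- case=> -[ex ey] _ h1 h2; subst.
    have /orP[] := square_antidiag hs h2 h1 => h; apply: (common _ h); rewrite adjacentE /=; lia.
  have /orP[] := square_antidiag hs h1 h2 => h; apply: (common _ h); rewrite adjacentE /=; lia.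
Qed.

Lemma chain_graphE n (B : polyomino_chain n) : graph B = cells_graph (squares B).
Proof.
apply/fsetP => e; rewrite mem_cells_graph !squaresE; apply/idP/idP.
  by move=> h; apply: edge_in_square (graph_system B) h.
case/orP=> h; apply: (sides_in_graph h); case: e {h} => [[x y] []];
  rewrite mem_sides /src /side_cell /=; lia.
Qed.

Lemma run_nth s i j k : (k <= j - i)%N -> (run s i j)`_[k] = s`_[i + k].
Proof. by move=> hk; rewrite /run nth_take ?nth_drop // ltnS. Qed.

Lemma run_size s i j : (i <= j)%N -> (j < size s)%N -> size (run s i j) = (j - i).+1.
Proof. by move=> hij hj; rewrite /run size_takel // size_drop; lia. Qed.

Lemma cell_chain_run s i j : cell_chain s -> (i <= j)%N -> (j < size s)%N ->
  cell_chain (run s i j).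
Proof.
move=> [hu ha hc] hij hj; have hs := run_size hij hj; split; rewrite ?hs.
- by rewrite take_uniq // drop_uniq.
- move=> k l hk hl; rewrite !run_nth; try lia.
  by rewrite ha; lia.
- move=> k l v hk hl; rewrite !run_nth; try lia.
  move=> h1 h2; have := hc _ _ _ _ _ h1 h2; lia.
Qed.

(** * Degrees count squares *)

Definition west (v : point) : point := (v.1 - 1, v.2).
Definition south (v : point) : point := (v.1, v.2 - 1).

Lemma degE G v : deg G v = (((v, false) \in G) + ((v, true) \in G) +
  ((west v, false) \in G) + ((south v, true) \in G))%N.
Proof.
pose l : seq segm := [:: (v, false); (v, true); (west v, false); (south v, true)].
have ul : uniq l.
  case: v @l => x y; rewrite /west /south /= !inE !xpair_eqE /= !eqxx !eqb_id eqbF_neg.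
  lia.
transitivity (count (fun e => e \in G) l); last by rewrite /= !addnA addn0.
rewrite -size_filter -(undup_id (filter_uniq _ ul)) -card_fseq /deg.
congr (#|` _|); apply/fsetP=> e; rewrite [RHS]in_fset [RHS]mem_filter !in_fset inE /=.
congr (_ && _).
case: v {ul} @l => x y; case: e => [[a b] c] /=; rewrite in_cons in_cons in_cons mem_seq1.
rewrite /src /tgt /west /south !xpair_eqE.
by case: c; rewrite /= ?eqb_id ?eqbF_neg /= !xpair_eqE; lia.
Qed.

Definition num_cells (s : seq cell) (v : point) : nat := count (fun c => v \in corners c) s.

Lemma num_cellsE s v : uniq s -> num_cells s v = (((v : cell) \in s) + (west v \in s) +
  (south v \in s) + (west (south v) \in s))%N.
Proof.
move=> us; pose l : seq cell := [:: v; west v; south v; west (south v)].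
have ul : uniq l.
  by case: v @l => x y; rewrite /west /south /= !inE !xpair_eqE /=; lia.
transitivity (count (fun c => c \in s) l); last by rewrite /= !addnA addn0.
rewrite /num_cells -!size_filter; apply: perm_size; apply: uniq_perm; rewrite ?filter_uniq // => c.
rewrite !mem_filter [RHS]andbC; congr (_ && _); rewrite mem_corners.
case: v {ul} @l => x y; case: c => a b /=; rewrite in_cons in_cons in_cons mem_seq1.
by rewrite /west /south !xpair_eqE /=; lia.
Qed.

(** An edge at [v] belongs to the graph when one of the two cells on its sides is a
    square.  Among the four cells around [v], all non-empty configurations of squares
    satisfy the formula except two opposite cells, which would have a common
    neighbour, and all four, which would form a cycle in the chain. *)
Lemma deg_cells_graph s v : cell_chain s -> (0 < num_cells s v)%N ->
  deg (cells_graph s) v = (num_cells s v).+1.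
Proof.
move=> hs; rewrite num_cellsE ?cell_chain_uniq // degE !mem_cells_graph.
rewrite /west /south /src /side_cell /=.
have diag c d : c \in s -> d \in s -> v \in corners c -> v \in corners d ->
    c != d -> ~~ adjacent c d -> exists2 e, e \in s & adjacent c e && adjacent e d.
  case: hs => hu ha hc.
  move=> /(nthP (0, 0))[i hi <-] /(nthP (0, 0))[j hj <-] h1 h2.
  have k1 := hc _ _ _ hi hj h1 h2; have k2 := hc _ _ _ hj hi h2 h1.
  have hm : ((maxn i j).-1 < size s)%N.
    by rewrite /maxn; case: ifP => _; apply: leq_ltn_trans (leq_pred _) _.
  rewrite nth_uniq // ha // => h3 h4; exists s`_[(maxn i j).-1]; first exact: mem_nth.
  by rewrite !ha //; lia.
have cyc a b c d : a \in s -> b \in s -> c \in s -> d \in s -> uniq [:: a; b; c; d] ->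
    [&& adjacent a b, adjacent b d, adjacent d c & adjacent c a] -> False.
  case: hs => hu ha hc.
  move=> /(nthP (0, 0))[i hi <-] /(nthP (0, 0))[j hj <-] /(nthP (0, 0))[k hk <-]
    /(nthP (0, 0))[l hl <-]; rewrite /= !inE !nth_uniq // !ha //; lia.
case: v diag cyc => x y diag cyc.
have c1 := cyc (x, y) (x - 1, y) (x, y - 1) (x - 1, y - 1).
have d1 := diag (x, y) (x - 1, y - 1).
have d2 := diag (x - 1, y) (x, y - 1).
rewrite !adjacentE !mem_corners !xpair_eqE /= in c1 d1 d2.
have nb (c d : cell) : adjacent c d -> [\/ d = (c.1, c.2 + 1), d = (c.1, c.2 - 1),
    d = (c.1 + 1, c.2) | d = (c.1 - 1, c.2)].
  case: c => a b; case: d => a' b'; rewrite adjacentE /=.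
  by case/orP=> /andP[/eqP<- /orP[/eqP<-|/eqP<-]];
    rewrite ?addrK; [constructor 1|constructor 2|constructor 3|constructor 4].
have {}d1 : (x, y) \in s -> (x - 1, y - 1) \in s -> ((x - 1, y) \in s) || ((x, y - 1) \in s).
  move=> h1 h2; have [||||e he /andP[/nb]] := d1 h1 h2; [clear; lia..|].
  case=> ee; move: he; rewrite ee adjacentE /= => he h; rewrite ?he ?orbT //;
  by move: h; clear; lia.
have {}d2 : (x - 1, y) \in s -> (x, y - 1) \in s -> ((x, y) \in s) || ((x - 1, y - 1) \in s).
  move=> h1 h2; have [||||e he /andP[/nb]] := d2 h1 h2; [clear; lia..|].
  case=> ee; move: he; rewrite ee adjacentE /= ?subrK => he h; rewrite ?he ?orbT //;
  by move: h; clear; lia.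
have {}c1 : (x, y) \in s -> (x - 1, y) \in s -> (x, y - 1) \in s -> (x - 1, y - 1) \in s -> False.
  by move=> h1 h2 h3 h4; apply: c1 => //; rewrite ?inE ?xpair_eqE /=; lia.
move: d1 d2 c1.
case: (_ \in s); case: (_ \in s); case: (_ \in s); case: (_ \in s) => //= d1 d2 c1;
  by [case: (c1 isT isT isT isT) | have := d1 isT isT | have := d2 isT isT].
Qed.

(** * Windows of five squares *)

(** Translations: [shift c] moves the cell [c] to the origin, and [place c] is its
    inverse. *)
Definition shift (c d : cell) : cell := (d.1 - c.1, d.2 - c.2).
Definition place (c : cell) (v : point) : point := (v.1 + c.1, v.2 + c.2).

Definition turn (s : seq cell) (i : nat) : bool :=
  shift s`_[i] s`_[i.+1] != shift s`_[i.-1] s`_[i].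

(** The type of a square: [None] for T, [Some true] for K, [Some false] for S. *)
Definition state (s : seq cell) (i : nat) : option bool :=
  if (0 < i)%N && (i.+1 < size s)%N then Some (turn s i) else None.

(** The neighbourhood of a square in its chain, relative to that square: the one or
    two squares before it and the one or two squares after it, nearest first. *)
Definition window : Type := (seq cell * seq cell)%type.
Definition origin : cell := (0, 0).

Definition window_at (s : seq cell) (i : nat) : window :=
  ([seq shift s`_[i] s`_[j] | j <- rev (iota (i - 2) (minn 2 i))],
   [seq shift s`_[i] s`_[j] | j <- iota i.+1 (minn 2 (size s - i.+1))]).

Definition window_cells (w : window) : seq cell := rev w.1 ++ origin :: w.2.

Definition directions : seq cell := [:: (1, 0); (-1, 0); (0, 1); (0, -1)].
Definition walks : seq (seq cell) :=
  [::] :: [seq [:: d] | d <- directions] ++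
  [seq [:: d; place d e] | d <- directions, e <- directions].

Definition strip_like (t : seq cell) : bool := uniq t &&
  all (fun i => all (fun j => adjacent t`_[i] t`_[j] == ((i.+1 == j) || (j.+1 == i)))
    (iota 0 (size t))) (iota 0 (size t)).

Definition windows : seq window :=
  [seq w <- [seq (l, r) | l <- walks, r <- walks] | strip_like (window_cells w)].

Lemma shift_adjacent a c d : adjacent (shift a c) (shift a d) = adjacent c d.
Proof. by case: a => x y; case: c => a b; case: d => a' b'; rewrite !adjacentE /=; lia. Qed.

Lemma shift_inj a : injective (shift a).
Proof.
by case: a => x y [a b] [a' b'] /eqP; rewrite /shift xpair_eqE /= => h; apply/eqP;
   rewrite xpair_eqE; lia.
Qed.

Lemma window_cellsE s i : (i < size s)%N -> window_cells (window_at s i) =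
  [seq shift s`_[i] s`_[j] | j <- iota (i - 2) (minn 2 i + (minn 2 (size s - i.+1)).+1)].
Proof.
move=> hi; rewrite /window_cells /window_at /= -map_rev revK iotaD map_cat /=.
have -> : (i - 2 + minn 2 i = i)%N by lia.
congr (_ ++ _ :: _); rewrite /shift; case: (s`_[i]) => x y; rewrite /= !subrr //.
Qed.

Lemma adjacent_directions c d : adjacent c d -> shift c d \in directions.
Proof.
by case: c => a b; case: d => x y; rewrite adjacentE !inE !xpair_eqE /=; lia.
Qed.

Lemma walk2 a b c : adjacent a b -> adjacent b c -> [:: shift a b; shift a c] \in walks.
Proof.
move=> h1 h2; rewrite /walks in_cons mem_cat; apply/orP; right; apply/orP; right.
apply/allpairsP; exists (shift a b, shift b c); rewrite !adjacent_directions //; split=> //=.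
by congr [:: _; _]; case: a b c {h1 h2} => [a1 a2] [b1 b2] [c1 c2]; rewrite /place /shift /=;
   congr (_, _); lia.
Qed.

Lemma walk1 a b : adjacent a b -> [:: shift a b] \in walks.
Proof.
move=> h; rewrite /walks in_cons mem_cat; apply/orP; right; apply/orP; left.
by apply/mapP; exists (shift a b) => //; apply: adjacent_directions.
Qed.

Lemma window_index n i j : (i < n)%N ->
  j \in iota (i - 2) (minn 2 i + (minn 2 (n - i.+1)).+1) -> (j < n)%N.
Proof. by rewrite mem_iota; lia. Qed.

Lemma left_indices i : rev (iota (i.+2 - 2) (minn 2 i.+2)) = [:: i.+1; i].
Proof.
have -> : (i.+2 - 2 = i)%N by lia.
by have -> : minn 2 i.+2 = 2%N by lia.
Qed.

Lemma window_at_mem s i : cell_chain s -> (i < size s)%N -> window_at s i \in windows.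
Proof.
move=> [hu ha hc] hi; rewrite /windows mem_filter; apply/andP; split.
  rewrite window_cellsE // /strip_like size_map size_iota; apply/andP; split.
    rewrite map_inj_in_uniq ?iota_uniq // => j k.
    move=> /(window_index hi) hj /(window_index hi) hk /shift_inj /eqP.
    by rewrite nth_uniq // => /eqP.
  apply/allP => j; rewrite mem_iota => hj; apply/allP => k; rewrite mem_iota => hk.
  do 2 (rewrite (nth_map 0%N) ?size_iota; last by lia).
  do 2 (rewrite nth_iota; last by lia).
  have hj' := window_index hi (j := (i - 2 + j)%N).
  have hk' := window_index hi (j := (i - 2 + k)%N).
  rewrite !mem_iota in hj' hk'.
  rewrite shift_adjacent ha; [|by apply: hj'; lia|by apply: hk'; lia].
  by apply/eqP; lia.
apply/allpairsP; exists ((window_at s i).1, (window_at s i).2); split=> //=.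
  case: i hi => [|[|i]] hi //; first by apply: walk1; rewrite ha //; lia.
  rewrite left_indices.
  by apply: walk2; rewrite ha //; lia.
case e : (size s - i.+1)%N => [|[|k]] //=.
  by apply: walk1; rewrite ha //; lia.
rewrite (_ : minn 2 k.+2 = 2)%N; last by lia.
by apply: walk2; rewrite ha //; lia.
Qed.

Lemma corner_place c d v : (place c v \in corners d) = (v \in corners (shift c d)).
Proof.
by case: c => a b; case: d => x y; case: v => v w; rewrite !mem_corners /=; lia.
Qed.

Definition window_deg (w : window) (v : point) : nat := (num_cells (window_cells w) v).+1.

(** Squares more than two steps away have no corner in common with the central
    square. *)
Lemma num_cells_window s i v : cell_chain s -> (i < size s)%N -> v \in corners origin ->
  num_cells s (place s`_[i] v) = num_cells (window_cells (window_at s i)) v.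
Proof.
move=> [hu ha hc] hi hv.
have [m em] : exists m, m = (minn 2 i + (minn 2 (size s - i.+1)).+1)%N.
  by exists (minn 2 i + (minn 2 (size s - i.+1)).+1)%N.
have hvi : place s`_[i] v \in corners s`_[i].
  by rewrite corner_place /shift !subrr.
rewrite window_cellsE // /num_cells count_map -em.
have count_nth P : count P s = count (preim (nth (0, 0) s) P) (iota 0 (size s)).
  by rewrite -count_map -[map _ _]/(mkseq _ _) mkseq_nth.
rewrite count_nth (_ : size s = (i - 2 + (m + (size s - (i - 2 + m))))%N); last by lia.
rewrite !iotaD !count_cat add0n.
have none k l : (forall j, (k <= j < k + l)%N -> (j < size s)%N /\ ((j.+2 < i) || (i.+2 < j))%N) ->
   count (preim (nth (0, 0) s) (fun c => place s`_[i] v \in corners c)) (iota k l) = 0%N.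
  move=> h; apply/eqP; rewrite -leqn0 leqNgt -has_count; apply/hasPn => j.
  rewrite mem_iota => /h[hj hij]; apply/negP => hvj.
  have := hc _ _ _ hi hj hvi hvj; have := hc _ _ _ hj hi hvj hvi; lia.
rewrite (none 0%N) ?(none (i - 2 + m)%N) ?add0n ?addn0; [|by move=> j; lia..].
by apply: eq_count => j /=; rewrite corner_place.
Qed.

Lemma deg_window s i v : cell_chain s -> (i < size s)%N -> v \in corners origin ->
  deg (cells_graph s) (place s`_[i] v) = window_deg (window_at s i) v.
Proof.
move=> hs hi hv; rewrite /window_deg -num_cells_window //; apply: deg_cells_graph => //.
rewrite -has_count; apply/hasP; exists s`_[i]; first exact: mem_nth.
by rewrite corner_place /shift !subrr.
Qed.

Definition window_state (w : window) : option bool :=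
  if w is (c :: _, d :: _) then Some (d != shift c origin) else None.

(** The type of the square next to the centre; a walk with fewer than two squares
    ends at a terminal one. *)
Definition walk_state (l : seq cell) : option bool :=
  if l is [:: c; d] then Some (d != place c c) else None.

Lemma state_window s i : (i < size s)%N -> state s i = window_state (window_at s i).
Proof.
case: i => [|i] hi //; rewrite /state /window_state /window_at.
have [t ->] : exists t, rev (iota (i.+1 - 2) (minn 2 i.+1)) = i :: t.
  by case: i {hi} => [|i]; [exists [::]|exists [:: i]; rewrite left_indices].
rewrite andTb; case e : (size s - i.+2)%N => [|k].
  by have -> : (i.+2 < size s)%N = false by lia.
have -> : (i.+2 < size s)%N by lia.
have -> : minn 2 k.+1 = (minn 1 k).+1 by lia.
congr (Some (_ != _)); rewrite /shift /=; case: (s`_[_]) => ? ?; case: (s`_[_]) => ? ?.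
by rewrite /= !sub0r !opprB.
Qed.

Lemma state_right s i : (i.+1 < size s)%N -> state s i.+1 = walk_state (window_at s i).2.
Proof.
move=> hi; rewrite /state /=.
case e : (size s - i.+1)%N => [|[|k]] /=; first by lia.
  by have -> : (i.+2 < size s)%N = false by lia.
have -> : (i.+2 < size s)%N by lia.
rewrite (_ : minn 2 k.+2 = 2)%N; last by lia.
rewrite /= /turn /=; congr (Some _); case: (s`_[_]) => a b; case: (s`_[_]) => a' b'.
by case: (s`_[_]) => x y; rewrite /shift /place !xpair_eqE /=; lia.
Qed.

Lemma state_left s i : (0 < i)%N -> (i < size s)%N ->
  state s i.-1 = walk_state (window_at s i).1.
Proof.
case: i => [|[|i]] // _ hi; rewrite /state /window_at left_indices /= hi.
rewrite /turn /=; congr (Some _); case: (s`_[_]) => a b; case: (s`_[_]) => a' b'.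
by case: (s`_[_]) => x y; rewrite /shift /place !xpair_eqE /=; lia.
Qed.

Definition ends (a b : nat) : nat * nat := (minn a b, maxn a b).

Definition side_degs (w : window) : seq (nat * nat) :=
  [seq ends (window_deg w (src e)) (window_deg w (tgt e)) | e <- sides origin].

Definition shared_degs (w : window) : seq (nat * nat) :=
  [seq ends (window_deg w (src e)) (window_deg w (tgt e)) |
     e <- sides origin & e \in sides (head origin w.2)].

Definition kinked (x : option bool) : bool := x == Some true.

(** The sides of a square of type [x] are distributed between its neighbours.  The
    part which is charged to a neighbour of type [y] is given by the degrees of the
    ends; whether the other neighbour is a kink does not affect it.  A terminal
    square has one neighbour, which takes all four sides. *)
Definition half_square (x y : option bool) : seq (nat * nat) :=
  match x with
  | None => [:: (2, 2); (2, 3); ends 2 (3 + kinked y); (3, 3 + kinked y)]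
  | Some false => nseq 2 (3, 3 + kinked y)
  | Some true => [:: (2, 3 + kinked y); (3 + kinked y, 4)]
  end%N.

(** The common side of two consecutive squares has an end of degree 4 for each kink
    among them. *)
Definition joint (x y : option bool) : nat * nat := ends (3 + kinked x) (3 + kinked y).

Definition window_cover (w : window) : seq (nat * nat) :=
  (if w.2 is [::] then [::] else half_square (window_state w) (walk_state w.2)) ++
  (if w.1 is [::] then [::] else half_square (window_state w) (walk_state w.1)).

(** The two outer kinks turn to the same side exactly when the middle square keeps
    a side whose ends lie in no third square. *)
Definition same_side_kinks (w : window) : bool :=
  [&& kinked (walk_state w.1), window_state w == Some false, kinked (walk_state w.2) &
      (3, 3)%N \in side_degs w].

Lemma windows_side_degs : all (fun w => (1 < size w.1 + size w.2)%N ==>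
  ~~ same_side_kinks w ==> perm_eq (side_degs w) (window_cover w)) windows.
Proof. by vm_compute. Qed.

Lemma windows_shared_degs : all (fun w => (1 < size w.1 + size w.2)%N ==> (w.2 != [::]) ==>
  (shared_degs w == [:: joint (window_state w) (walk_state w.2)])) windows.
Proof. by vm_compute. Qed.

Lemma windows_kink : all (fun w => (w.1 != [::]) ==> (w.2 != [::]) ==>
  (has (fun v => window_deg w v == 2)%N (corners origin) == kinked (window_state w))) windows.
Proof. by vm_compute. Qed.

Lemma cell_chain_behead c s : cell_chain (c :: s) -> cell_chain s.
Proof.
move=> [/= /andP[_ hu] ha hc]; split=> // i j.
  by move=> hi hj; apply: (ha i.+1 j.+1).
by move=> v hi hj h1 h2; apply: (hc i.+1 j.+1 v).
Qed.

Lemma sides_uniq c : uniq (sides c).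
Proof. by case: c => a b; rewrite /= !inE !xpair_eqE /= ?eqxx ?eqb_id ?eqbF_neg; lia. Qed.

(** * The index as a sum over consecutive squares *)

(** Inclusion and exclusion: only consecutive squares have a side in common. *)
Lemma sum_cells_graph (R : zmodType) (w : segm -> R) s : cell_chain s ->
  \sum_(e <- cells_graph s) w e =
  \sum_(0 <= i < size s) \sum_(e <- sides s`_[i]) w e -
  \sum_(0 <= i < (size s).-1) \sum_(e <- sides s`_[i] | e \in sides s`_[i.+1]) w e.
Proof.
move=> hs; transitivity (\sum_(e <- undup (flatten [seq sides c | c <- s])) w e).
  apply: perm_big; apply: uniq_perm; rewrite ?fset_uniq ?undup_uniq // => e.
  by rewrite mem_undup /cells_graph in_fset.
elim: s hs => [|c s IH] hs; first by rewrite !big_nil subr0.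
have {}IH := IH (cell_chain_behead hs).
rewrite [flatten _](_ : _ = sides c ++ flatten [seq sides d | d <- s]) //.
rewrite undup_cat big_cat IH (undup_id (sides_uniq c)) big_filter.
rewrite [size (c :: s)]/= big_nat_recl // -pred_Sn.
set F := flatten _.
have -> : \sum_(e <- sides c | e \notin F) w e =
   \sum_(e <- sides c) w e - \sum_(e <- sides c | e \in F) w e.
  by apply/esym/(canLR (addrK _)); rewrite [LHS](bigID (fun e => e \in F)) addrC.
have -> : \sum_(0 <= i < size s) \sum_(e <- sides (c :: s)`_[i] | e \in sides (s`_[i])) w e =
   \sum_(e <- sides c | e \in F) w e +
   \sum_(0 <= i < (size s).-1) \sum_(e <- sides s`_[i] | e \in sides (s`_[i.+1])) w e.
  case: s hs @F {IH} => [|d s] hs F.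
    by rewrite !big_geq // addr0 /F big1.
  rewrite [size (d :: s)]/= big_nat_recl //; congr (_ + _).
  rewrite big_seq_cond [RHS]big_seq_cond; apply: eq_bigl => e.
  case hc : (e \in sides c) => //.
  rewrite /F -[flatten _]/(sides d ++ flatten [seq sides d | d <- s]) mem_cat !andTb.
  case hd : (e \in sides d) => //; rewrite orFb; apply/esym/negbTE/flatten_mapP => -[x hx he].
  have [k hk ek] := nthP (0, 0) hx; have [_ ha _] := hs.
  have := ha 0%N k.+2 isT; rewrite /= !ltnS => /(_ hk); rewrite ek => had.
  case/negP: (negbT had); rewrite /adjacent.
  have hcx : c != x.
    apply: contraTneq hx => <-; have := cell_chain_uniq hs; rewrite /= inE negb_or.
    by case/andP=> /andP[].
  by rewrite hcx; apply/hasP; exists e.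
by rewrite opprD addrACA.
Qed.

Lemma window_at_sizes s i : (i < size s)%N ->
  [/\ ((window_at s i).1 != [::]) = (0 < i)%N, ((window_at s i).2 != [::]) = (i.+1 < size s)%N &
      (2 < size s)%N -> (1 < size (window_at s i).1 + size (window_at s i).2)%N].
Proof.
move=> hi; have h1 : size (window_at s i).1 = minn 2 i by rewrite size_map size_rev size_iota.
have h2 : size (window_at s i).2 = minn 2 (size s - i.+1) by rewrite size_map size_iota.
by split; rewrite -?size_eq0 ?h1 ?h2; lia.
Qed.

Lemma side_corners e : e \in sides origin -> src e \in corners origin /\ tgt e \in corners origin.
Proof.
by case: e => [[x y] []]; rewrite mem_sides !mem_corners /src /tgt /=; lia.
Qed.

Lemma shift_side c d e : (e \in sides (shift c d)) =
  (((place c e.1, e.2) : segm) \in sides d).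
Proof. by case: c d => a b [a' b']; case: e => [[x y] []]; rewrite !mem_sides /=; lia. Qed.

Lemma place_tgt c (e : segm) : tgt (place c e.1, e.2) = place c (tgt e).
Proof.
by case: c => a b; case: e => [[x y] []]; rewrite /tgt /place /=; congr (_, _); lia.
Qed.

Section Formula.
Variables (R : realType) (f : nat -> nat -> R).
Hypothesis f_sym : forall a b, f a b = f b a.

Definition weight (p : nat * nat) : R := f p.1 p.2.

Lemma weight_ends a b : weight (ends a b) = f a b.
Proof. by rewrite /weight /ends /minn /maxn; case: ifP. Qed.

Lemma sides_place c : sides c = [seq ((place c e.1, e.2) : segm) | e <- sides origin].
Proof.
by case: c => a b; rewrite /sides /place /=;
   congr [:: (_, _, _); (_, _, _); (_, _, _); (_, _, _)]; lia.
Qed.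

Lemma sum_square s i (P : pred segm) : cell_chain s -> (i < size s)%N ->
  \sum_(e <- sides s`_[i] | P e)
     f (deg (cells_graph s) (src e)) (deg (cells_graph s) (tgt e)) =
  \sum_(e <- sides origin | P (place s`_[i] e.1, e.2))
     weight (ends (window_deg (window_at s i) (src e)) (window_deg (window_at s i) (tgt e))).
Proof.
move=> hs hi; rewrite sides_place big_map big_seq_cond [RHS]big_seq_cond.
apply: eq_bigr => e /andP[/side_corners[h1 h2] _]; rewrite weight_ends -!deg_window //.
by rewrite place_tgt.
Qed.

Definition joint_weight (x y : option bool) : R :=
  \sum_(p <- half_square x y) weight p + \sum_(p <- half_square y x) weight p -
  weight (joint x y).

Lemma TI_cells_graph s : cell_chain s -> (2 < size s)%N ->
  (forall i, (i < size s)%N -> ~~ same_side_kinks (window_at s i)) ->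
  TI f (cells_graph s) =
  \sum_(0 <= i < (size s).-1) joint_weight (state s i) (state s i.+1).
Proof.
move=> hs h3 hk; rewrite /TI sum_cells_graph //.
have sq i : (i < size s)%N ->
    \sum_(e <- sides s`_[i]) f (deg (cells_graph s) (src e)) (deg (cells_graph s) (tgt e)) =
    (if (i.+1 < size s)%N then \sum_(p <- half_square (state s i) (state s i.+1)) weight p else 0) +
    (if (0 < i)%N then \sum_(p <- half_square (state s i) (state s i.-1)) weight p else 0).
  move=> hi; rewrite sum_square //; have hw := window_at_mem hs hi.
  have [w1 w2 /(_ h3) w3] := window_at_sizes hi.
  have := allP windows_side_degs _ hw; rewrite w3 hk //= => hp.
  rewrite -(big_map (fun e => ends _ _) xpredT weight) -[map _ _]/(side_degs (window_at s i)).
  rewrite (perm_big _ hp) /window_cover big_cat -w1 -w2 state_window //; congr (_ + _).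
    case e : (window_at s i).2 => [|d l]; first by rewrite big_nil.
    by rewrite /= state_right ?e // -w2 e.
  case e : (window_at s i).1 => [|d l]; first by rewrite big_nil.
  by rewrite /= state_left ?e // -w1 e.
have sh i : (i.+1 < size s)%N -> \sum_(e <- sides s`_[i] | e \in sides s`_[i.+1])
    f (deg (cells_graph s) (src e)) (deg (cells_graph s) (tgt e)) =
    weight (joint (state s i) (state s i.+1)).
  move=> hi1; have hi := ltnW hi1; rewrite sum_square //; have hw := window_at_mem hs hi.
  have [w1 w2 /(_ h3) w3] := window_at_sizes hi.
  have := allP windows_shared_degs _ hw; rewrite w3 w2 hi1 => /eqP hp.
  rewrite state_window // state_right // -[RHS](big_seq1 +%R) -hp /shared_degs big_map big_filter.
  apply: eq_bigl => e; rewrite -shift_side /window_at /=.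
  by rewrite (_ : minn 2 _ = (minn 1 (size s - i.+2)).+1)%N //; lia.
case: (size s) h3 sq sh => // m h3 sq sh; rewrite -pred_Sn.
have -> : \sum_(0 <= i < m.+1) \sum_(e <- sides s`_[i])
    f (deg (cells_graph s) (src e)) (deg (cells_graph s) (tgt e)) =
  \sum_(0 <= i < m) \sum_(p <- half_square (state s i) (state s i.+1)) weight p +
  \sum_(0 <= i < m) \sum_(p <- half_square (state s i.+1) (state s i)) weight p.
  have sq' i (hi : (0 <= i < m.+1)%N) := sq i hi.
  rewrite (eq_big_nat _ _ sq').
  rewrite big_split /= big_nat_recr //= ltnn addr0 [X in _ + X = _]big_nat_recl //= add0r.
  by congr (_ + _); apply: eq_big_nat => i /andP[_ hi] //; rewrite ltnS hi.
rewrite -big_split -sumrB /=; apply: eq_big_nat => i hi.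
by rewrite sh //; apply: hi.
Qed.
End Formula.

(** * Kinks, segments and Omega *)

Lemma num_adjacent_nth s i : cell_chain s -> (i < size s)%N ->
  num_adjacent s s`_[i] = ((0 < i) + (i.+1 < size s))%N.
Proof.
move=> [hu ha _] hi; rewrite /num_adjacent.
transitivity (count (predU (pred1 i.-1) (pred1 i.+1)) [seq j <- iota 0 (size s) | j != i]).
  rewrite -{2}(mkseq_nth (0, 0) s) count_map count_filter; apply: eq_in_count => j.
  by rewrite mem_iota /= => hj; rewrite ha //; lia.
have := count_predUI (pred1 i.-1) (pred1 i.+1) [seq j <- iota 0 (size s) | j != i].
rewrite (eq_count (a1 := predI _ _) (a2 := pred0)) => [|j /=]; last by lia.
rewrite count_pred0 addn0 => ->.
rewrite !count_uniq_mem ?filter_uniq ?iota_uniq // !mem_filter !mem_iota; lia.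
Qed.

Lemma corners_place c : corners c = [seq place c v | v <- corners origin].
Proof.
by case: c => a b; rewrite /corners /place /=; congr [:: (_, _); (_, _); (_, _); (_, _)]; lia.
Qed.

Lemma kink_nth s i : cell_chain s -> (i < size s)%N ->
  kink (cells_graph s) s s`_[i] = kinked (state s i).
Proof.
move=> hs hi; rewrite /kink /nonterminal mem_nth // num_adjacent_nth // andTb.
have [w1 w2 _] := window_at_sizes hi.
have := allP windows_kink _ (window_at_mem hs hi); rewrite w1 w2 -state_window // /state.
case: (posnP i) => [i0|i0]; first by case: (_ < _)%N.
case: (ltnP i.+1 (size s)) => hi1 // /eqP <-.
rewrite corners_place has_map; apply: eq_in_has => v hv.
by rewrite [LHS]/= deg_window.
Qed.

Lemma terminal_nth s i : cell_chain s -> (i < size s)%N -> (2 < size s)%N ->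
  terminal s s`_[i] = (state s i == None).
Proof.
move=> hs hi h3; rewrite /terminal mem_nth // num_adjacent_nth // /state andTb.
by case: ifP => h; [apply/negbTE|rewrite eqxx]; lia.
Qed.

Lemma state_run s i j k : (i <= j)%N -> (j < size s)%N -> (k <= j - i)%N ->
  state (run s i j) k = if (i < i + k < j)%N then Some (turn s (i + k)) else None.
Proof.
move=> hij hj hk; rewrite /state run_size //.
have -> : (0 < k)%N && (k.+1 < (j - i).+1)%N = (i < i + k < j)%N by lia.
case: ifP => // h; rewrite /turn !run_nth; try lia.
by congr (Some (shift _ s`_[_] != shift s`_[_] _)); lia.
Qed.

Lemma linear_runP s i j : cell_chain s ->
  reflect ((i <= j < size s)%N /\ forall m, (i < m < j)%N -> ~~ turn s m) (linear_run s i j).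
Proof.
move=> hs; rewrite /linear_run; case: (leqP i j) => hij; last by right; lia.
case: (ltnP j (size s)) => hj; last by right; lia.
have hr := cell_chain_run hs hij hj; have sr := run_size hij hj.
apply: (iffP allP) => [h|[_ h] c].
  split=> // m hm; have hk : (m - i < size (run s i j))%N by rewrite sr; lia.
  have := h _ (mem_nth (0, 0) hk); rewrite kink_nth // state_run //; last by lia.
  rewrite (_ : i + (m - i) = m)%N; last by lia.
  by rewrite hm; case: (turn s m).
case/(nthP (0, 0)) => k hk <-; rewrite kink_nth //; rewrite sr in hk; rewrite state_run //.
by case: ifP => // /h; case: (turn _ _).
Qed.

Lemma kinked_turn s i : kinked (state s i) -> [/\ (0 < i)%N, (i.+1 < size s)%N & turn s i].
Proof. by rewrite /state; case: ifP => // /andP[h1 h2] /eqP[]. Qed.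

(** Kinks are where segments end: no linear run contains a kink in its interior, and
    a run which ends at a kink extends on the other side to a segment. *)
Lemma internal_between_kinks s i : cell_chain s ->
  kinked (state s i) -> state s i.+1 = Some false -> kinked (state s i.+2) ->
  internal_segment s i i.+2.
Proof.
move=> hs /kinked_turn[i0 i1 ti] st /kinked_turn[_ i3 ti2].
have ti1 : ~~ turn s i.+1 by move: st; rewrite /state; case: ifP => // _ [->].
split.
- split.
    by apply/(linear_runP _ _ hs); split=> [|m hm]; [lia|rewrite (_ : m = i.+1) //; lia].
  move=> i' j' hi' hj' /(linear_runP _ _ hs)[hb h]; split.
    apply/eqP; rewrite eqn_leq hi' leqNgt; apply/negP => hlt.
    by have := h i; rewrite ti; lia.
  apply/eqP; rewrite eqn_leq hj' andbT leqNgt; apply/negP => hlt.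
  by have := h i.+2; rewrite ti2; lia.
- have ex : exists a, linear_run s a i.
    by exists i; apply/(linear_runP _ _ hs); split; lia.
  have h0 : linear_run s i.-1 i by apply/(linear_runP _ _ hs); split; lia.
  case: (ex_minnP ex) => a ha hmin; exists a, i; split; last by have := hmin _ h0; lia.
  split=> // i' j' hi' hj' h; have lt_a := hmin _ h0.
  have hj : j' = i.
    apply/eqP; rewrite eqn_leq hj' andbT leqNgt; apply/negP => hlt.
    by case/(linear_runP _ _ hs): h => _ /(_ i); rewrite ti; lia.
  by rewrite hj in h *; have := hmin _ h; lia.
- have h0 : linear_run s i.+2 i.+3 by apply/(linear_runP _ _ hs); split; lia.
  have ex : exists b, linear_run s i.+2 b by exists i.+3.
  have ub b : linear_run s i.+2 b -> (b <= size s)%N by case/(linear_runP _ _ hs); lia.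
  case: (ex_maxnP ex ub) => b hb hmax; exists i.+2, b; split; last by lia.
  split=> // i' j' hi' hj' h; have lt_b := hmax _ h0.
  have hi : i' = i.+2.
    apply/eqP; rewrite eqn_leq hi' leqNgt; apply/negP => hlt.
    by case/(linear_runP _ _ hs): h => _ /(_ i.+2); rewrite ti2; lia.
  by rewrite hi in h *; have := hmax _ h; lia.
Qed.

Lemma Omega_no_same_side n (B : polyomino_chain n) i : Omega B -> (i < n)%N ->
  ~~ same_side_kinks (window_at (squares B) i).
Proof.
move=> hO; rewrite -[X in (i < X)%N](size_squares B); set s := squares B => hi.
have hs : cell_chain s := squares_cell_chain B.
apply/negP => /and4P[kl /eqP st kr /mapP[e he [h1 h2]]].
have i0 : (0 < i)%N by have [<- _ _] := window_at_sizes hi; case: (window_at s i).1 kl.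
have i1 : (i.+1 < size s)%N by have [_ <- _] := window_at_sizes hi; case: (window_at s i).2 kr.
rewrite -state_left // in kl; rewrite -state_window // in st; rewrite -state_right // in kr.
case: i hi st i0 i1 kr kl h1 h2 => // i hi st _ i1 kr kl h1 h2.
have hsz : size (run s i i.+2) = 3%N by rewrite run_size; lia.
pose e' : segm := (place s`_[i.+1] e.1, e.2).
have he' : e' \in sides s`_[i.+1] by rewrite sides_place; apply: map_f.
have hin : e' \in cells_graph (run s i i.+2).
  rewrite in_fset; apply/flatten_mapP; exists s`_[i.+1] => //.
  have hr : (run s i i.+2)`_[1] = s`_[i.+1] by rewrite run_nth ?addn1 //; lia.
  by rewrite -hr mem_nth // hsz.
have [c1 c2] := side_corners he.
apply: (hO _ _ (internal_between_kinks hs kl st kr) hsz _ hin).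
rewrite chain_graphE place_tgt -[src e']/(place _ (src e)).
by rewrite !deg_window // -/s; lia.
Qed.

(** * Invariance under isomorphism *)

(** The edges with both orientations: a graph isomorphism acts on ordered pairs of
    adjacent vertices, while it does not respect the lattice orientation. *)
Definition darts (G : lgraph) : seq (point * point) :=
  [seq (src e, tgt e) | e <- G] ++ [seq (tgt e, src e) | e <- G].

Lemma mem_darts G u v : ((u, v) \in darts G) = adj G u v.
Proof.
rewrite mem_cat; apply/orP/adjP.
  by case=> /mapP[e he [-> ->]]; exists e => //; [left|right].
by case=> e he [] [<- <-]; [left|right]; apply/mapP; exists e.
Qed.

Lemma segm_not_reversed e e' : src e = tgt e' -> tgt e = src e' -> False.
Proof.
case: e => [[x y] []]; case: e' => [[x' y'] []];
  rewrite /src /tgt /= => -[h1 h2] [h3 h4]; lia.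
Qed.

Lemma darts_uniq G : uniq (darts G).
Proof.
rewrite cat_uniq; apply/and3P; split.
- by rewrite map_inj_uniq ?fset_uniq // => e e' [h1 h2]; apply: segm_eq.
- apply/hasPn => d /mapP[e he ->]; apply/mapP => -[e' he' [h1 h2]].
  exact: (segm_not_reversed (esym h1) (esym h2)).
- by rewrite map_inj_uniq ?fset_uniq // => e e' [h1 h2]; apply: segm_eq.
Qed.

Lemma deg_darts G v : deg G v = count (fun d => d.1 == v) (darts G).
Proof.
rewrite count_cat !count_map /deg.
transitivity (count (fun e => (src e == v) || (tgt e == v)) G).
  rewrite -size_filter -(undup_id (filter_uniq _ (fset_uniq _))) -card_fseq.
  by congr (#|` _|); apply/fsetP => e; rewrite [RHS]in_fset [RHS]mem_filter !in_fset inE andbC.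
have := count_predUI (fun e => src e == v) (fun e => tgt e == v) G.
rewrite (eq_count (a1 := predI _ _) (a2 := pred0)) => [|e /=].
  by rewrite count_pred0 addn0.
by apply/negbTE/andP => -[/eqP h1 /eqP h2]; have := src_tgt_neq e; rewrite h1 h2 eqxx.
Qed.

Lemma TI_darts (R : realType) (f : nat -> nat -> R) G : (forall a b, f a b = f b a) ->
  TI f G *+ 2 = \sum_(d <- darts G) f (deg G d.1) (deg G d.2).
Proof.
move=> f_sym; rewrite big_cat !big_map /= mulr2n; congr (_ + _).
by apply: eq_bigr => e _; apply: f_sym.
Qed.

Lemma adj_vertices G u v : adj G u v -> u \in vertices G /\ v \in vertices G.
Proof. by case/adjP=> e he [] [<- <-]; split; rewrite ?src_vertex ?tgt_vertex. Qed.

Lemma TI_iso (R : realType) (f : nat -> nat -> R) G H : (forall a b, f a b = f b a) ->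
  graph_iso G H -> TI f G = TI f H.
Proof.
move=> f_sym [phi [hi hv ha]].
have hperm : perm_eq [seq (phi d.1, phi d.2) | d <- darts G] (darts H).
  apply: uniq_perm; rewrite ?darts_uniq //.
    rewrite map_inj_in_uniq ?darts_uniq // => -[u v] [u' v']; rewrite !mem_darts.
    by move=> /adj_vertices[h1 h2] /adj_vertices[h3 h4] [/hi -> // /hi ->].
  case=> u v; rewrite mem_darts; apply/mapP/idP.
    by case=> -[u' v']; rewrite mem_darts => h [-> ->]; have [h1 h2] := adj_vertices h; rewrite ha.
  move=> h; have [] := adj_vertices h; rewrite -hv => /imfsetP[u' /= hu eu] /imfsetP[v' /= hv' ev].
  by exists (u', v'); rewrite ?eu ?ev // mem_darts -ha // -eu -ev.
have hdeg u : u \in vertices G -> deg H (phi u) = deg G u.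
  move=> hu; rewrite !deg_darts -(permP hperm) count_map; apply: eq_in_count => -[x y].
  by rewrite mem_darts => /adj_vertices[hx _] /=; apply/eqP/eqP => [/hi ->|->].
have : TI f G *+ 2 = TI f H *+ 2.
  rewrite !TI_darts // -(perm_big _ hperm) big_map [LHS]big_seq [RHS]big_seq.
  by apply: eq_bigr => -[x y]; rewrite mem_darts => /adj_vertices[hx hy] /=; rewrite !hdeg.
by rewrite !mulr2n; lra.
Qed.

(** * Congruence of chains *)

(** A motion of the lattice consists of its action on points and its action on
    cells, which differ because a cell is named by its lower left corner. *)
Definition motion (phi phi' : point -> point) (psi psi' : cell -> cell) : Prop :=
  [/\ cancel phi phi' /\ cancel phi' phi, cancel psi psi' /\ cancel psi' psi,
      forall v c, (phi v \in corners (psi c)) = (v \in corners c) &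
      forall u v, adjacent (phi u) (phi v) = adjacent u v].

Lemma motion_inv phi phi' psi psi' :
  motion phi phi' psi psi' -> motion phi' phi psi' psi.
Proof.
move=> [[h1 h2] [h3 h4] hc ha]; split=> //.
  by move=> v c; rewrite -hc h2 h4.
by move=> u v; rewrite -ha !h2.
Qed.

Lemma motion_comp phi phi' psi psi' rho rho' tau tau' :
  motion phi phi' psi psi' -> motion rho rho' tau tau' ->
  motion (rho \o phi) (phi' \o rho') (tau \o psi) (psi' \o tau').
Proof.
move=> [[h1 h2] [h3 h4] hc ha] [[k1 k2] [k3 k4] kc ka]; split; [split|split| |] => //=;
 try (by apply: can_comp).
  by move=> v c; rewrite kc hc.
by move=> u v; rewrite ka ha.
Qed.

(** Points and cells have the same type, and [adjacent] on points says that they are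
    at distance one. *)
Lemma adj_cells_graph s u v : adj (cells_graph s) u v =
  adjacent u v && has (fun c => (u \in corners c) && (v \in corners c)) s.
Proof.
apply/adjP/andP.
  case=> e; rewrite in_fset => /flatten_mapP[c hc he] huv.
  have h : [/\ adjacent (src e) (tgt e), src e \in corners c & tgt e \in corners c].
    move: he; rewrite mem_sides !mem_corners adjacentE.
    by case: e {huv} => [[x y] []]; rewrite /src /tgt /= => h; split; lia.
  case: h => h1 h2 h3; case: huv => -[<- <-]; split=> //.
  - by apply/hasP; exists c => //; rewrite h2.
  - by move: h1; rewrite !adjacentE; lia.
  - by apply/hasP; exists c => //; rewrite h2 andbT.
case=> h /hasP[c hc /andP[hu hv]].
pose e : segm := ((Num.min u.1 v.1, Num.min u.2 v.2), u.1 == v.1).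
have [h1 h2] : e \in sides c /\ ((src e = u /\ tgt e = v) \/ (src e = v /\ tgt e = u)).
  move: h hu hv; rewrite mem_sides adjacentE !mem_corners /src /tgt /e {e}.
  case: u => a b {hc}; case: v => a' b'; case: c => x y /=.
  case/orP=> /andP[/eqP<- /orP[/eqP<-|/eqP<-]] h1 h2.
  - rewrite minxx eqxx (min_idPl _); last by lia.
    by split; [lia|left].
  - rewrite minxx eqxx (min_idPr _); last by lia.
    by split; [lia|right].
  - rewrite minxx (min_idPl _); last by lia.
    by have -> : (a == a + 1) = false; [lia|split; [lia|left]].
  - rewrite minxx (min_idPr _); last by lia.
    by have -> : (a' + 1 == a') = false; [lia|split; [lia|right]].
by exists e => //; rewrite in_fset; apply/flatten_mapP; exists c.
Qed.

Lemma mem_vertices_cells_graph s v :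
  (v \in vertices (cells_graph s)) = has (fun c => v \in corners c) s.
Proof.
rewrite in_fsetU; apply/orP/hasP.
  case=> /imfsetP[e /=]; rewrite in_fset => /flatten_mapP[c hc he] ->; exists c => //;
  by move: he; rewrite mem_sides !mem_corners; case: e => [[x y] []]; rewrite /src /tgt /=; lia.
case=> c hc; rewrite mem_corners => hv.
suff: exists2 e, e \in sides c & (v == src e) || (v == tgt e).
  case=> e he /orP[] /eqP ->; [left|right]; apply/imfsetP; exists e => //=;
  by rewrite in_fset; apply/flatten_mapP; exists c.
case: c hv {hc} => a b; case: v => x y /= /andP[h1 h2].
exists ((a, if y == b then b else b + 1), false).
  by rewrite mem_sides /=; case: (y == b); lia.
by rewrite /src /tgt /= !xpair_eqE; case: ifP; lia.
Qed.

Lemma motion_graph_iso phi phi' psi psi' s :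
  motion phi phi' psi psi' -> graph_iso (cells_graph s) (cells_graph [seq psi c | c <- s]).
Proof.
move=> [[h1 h2] _ hc ha]; exists phi; split.
- by move=> u v _ _; apply: (can_inj h1).
- apply/fsetP => v; rewrite mem_vertices_cells_graph has_map; apply/imfsetP/hasP.
    case=> u /=; rewrite mem_vertices_cells_graph => /hasP[c hcs hu] ->.
    by exists c => //=; rewrite hc.
  case=> c hcs /= hv; exists (phi' v); rewrite ?h2 //= mem_vertices_cells_graph.
  by apply/hasP; exists c; rewrite // -hc h2.
move=> u v _ _; rewrite !adj_cells_graph ha has_map; congr (_ && _).
by apply: eq_has => c /=; rewrite !hc.
Qed.

Record frame := Frame { base : cell; swapped : bool; flip1 : bool; flip2 : bool }.

Definition flip (b : bool) (x : int) : int := if b then - x else x.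

Definition rotate (g : frame) (v : point) : point :=
  if swapped g then (flip (flip1 g) v.2, flip (flip2 g) v.1)
  else (flip (flip1 g) v.1, flip (flip2 g) v.2).

Definition unrotate (g : frame) (v : point) : point :=
  if swapped g then (flip (flip2 g) v.2, flip (flip1 g) v.1)
  else (flip (flip1 g) v.1, flip (flip2 g) v.2).

(** A reflection sends the lower left corner of a cell to another corner of the
    image cell, hence the shift by one in each reflected coordinate. *)
Definition corner_base (g : frame) : point :=
  ((base g).1 + (flip1 g)%:R, (base g).2 + (flip2 g)%:R).

Lemma frame_motion g : motion
  (fun v => place (corner_base g) (rotate g v)) (fun v => unrotate g (shift (corner_base g) v))
  (fun c => place (base g) (rotate g c)) (fun c => unrotate g (shift (base g) c)).
Proof.
case: g => -[a b] sw f1 f2; rewrite /corner_base /place /shift /=; split; [split|split| |].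
1-4: case=> x y; rewrite /rotate /unrotate /flip /=;
  by case: sw; case: f1; case: f2 => /=; congr (_, _); lia.
- case=> x y [x' y']; rewrite !mem_corners /rotate /flip /=.
  by case: sw; case: f1; case: f2 => /=; lia.
- case=> x y [x' y']; rewrite !adjacentE /rotate /flip /=.
  by case: sw; case: f1; case: f2 => /=; lia.
Qed.

Fixpoint walk_cell (d : nat -> cell) (i : nat) : cell :=
  if i is j.+1 then place (walk_cell d j) (d j) else origin.

Lemma framed_walk g d s : (0 < size s)%N -> base g = s`_[0] ->
  (forall i, (i.+1 < size s)%N -> shift s`_[i] s`_[i.+1] = rotate g (d i)) ->
  s = [seq place (base g) (rotate g c) | c <- mkseq (walk_cell d) (size s)].
Proof.
move=> h0 hb hd; apply: (@eq_from_nth _ (0, 0)) => [|i hi]; first by rewrite size_map size_mkseq.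
rewrite (nth_map (0, 0)) ?size_mkseq // nth_mkseq //.
elim: i hi => [|i IH] hi.
  by rewrite -hb; case: g {hb hd} => -[a b] [] [] []; rewrite /place /rotate /flip /= ?oppr0 !add0r.
have := hd i hi; rewrite (IH (ltnW hi)) /=; case: (s`_[_]) => x y.
move: (walk_cell d i) (d i) => [a b] [a' b']; case: g {hb hd IH} => -[u v] [] [] [];
  rewrite /place /rotate /flip /shift /= => -[h1 h2]; congr (_, _); lia.
Qed.

(** Two chains with the same sequence of steps, each read in its own frame, are
    both images of one model chain. *)
Lemma same_walk_iso g h d s t : size s = size t -> (0 < size s)%N ->
  base g = s`_[0] -> base h = t`_[0] ->
  (forall i, (i.+1 < size s)%N -> shift s`_[i] s`_[i.+1] = rotate g (d i)) ->
  (forall i, (i.+1 < size t)%N -> shift t`_[i] t`_[i.+1] = rotate h (d i)) ->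
  graph_iso (cells_graph s) (cells_graph t).
Proof.
move=> hst h0 hg hh hs ht.
have h0' : (0 < size t)%N by rewrite -hst.
have es := framed_walk h0 hg hs; have et := framed_walk h0' hh ht; rewrite -hst in et.
have m := motion_comp (motion_inv (frame_motion g)) (frame_motion h).
have := motion_graph_iso s m; congr (graph_iso _ (cells_graph _)).
rewrite [RHS]et {1}es -map_comp; apply: eq_map => c /=.
by have [_ [-> _] _ _] := frame_motion g.
Qed.

Definition step_x : cell := (1, 0).
Definition step_y : cell := (0, 1).

Lemma frame_exists c u v : u \in directions -> v \in directions -> v != u ->
  v != shift u origin -> exists g, [/\ base g = c, rotate g step_x = u & rotate g step_y = v].
Proof.
by rewrite !inE; case/or4P=> /eqP-> /or4P[] /eqP-> // _ _;
 [exists (Frame c false false false)|exists (Frame c false false true)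
 |exists (Frame c false true false)|exists (Frame c false true true)
 |exists (Frame c true false false)|exists (Frame c true true false)
 |exists (Frame c true false true)|exists (Frame c true true true)].
Qed.

(** Two consecutive kinks turn to opposite sides, for otherwise four squares would
    form a block of two by two. *)
Lemma zigzag_directions : all (fun u => all (fun v => all (fun w =>
   [&& v != u, v != shift u origin, w != v, w != shift v origin &
       ~~ adjacent origin (place (place u v) w)] ==> (w == u)) directions) directions) directions.
Proof. by vm_compute. Qed.

Lemma step_direction s i : cell_chain s -> (i.+1 < size s)%N ->
  shift s`_[i] s`_[i.+1] \in directions.
Proof.
by move=> [_ ha _] hi; apply: adjacent_directions; rewrite ha ?eqxx // ltnW.
Qed.

Lemma no_backtrack s i : cell_chain s -> (i.+2 < size s)%N ->
  shift s`_[i.+1] s`_[i.+2] != shift (shift s`_[i] s`_[i.+1]) origin.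
Proof.
move=> [hu _ _] hi; have := nth_uniq (0, 0) hi (ltnW (ltnW hi)) hu.
rewrite (_ : (i.+2 == i) = false); last by lia.
apply: contraFneq; case: (s`_[i]) => a b; case: (s`_[i.+1]) => a' b'; case: (s`_[i.+2]) => x y.
by rewrite /shift /= => -[h1 h2]; apply/eqP; congr (_, _); lia.
Qed.

Lemma straight_iso s t : cell_chain s -> cell_chain t -> size s = size t -> (2 < size s)%N ->
  (forall i, (i < size s)%N -> ~~ kinked (state s i)) ->
  (forall i, (i < size t)%N -> ~~ kinked (state t i)) ->
  graph_iso (cells_graph s) (cells_graph t).
Proof.
move=> hs ht hst h3.
have framed r : cell_chain r -> (2 < size r)%N ->
    (forall i, (i < size r)%N -> ~~ kinked (state r i)) ->
    exists2 g, base g = r`_[0] &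
      forall i, (i.+1 < size r)%N -> shift r`_[i] r`_[i.+1] = rotate g step_x.
  move=> hr hr3 hk; have hu := step_direction hr (ltnW hr3).
  have [v hv] : exists v, [&& v \in directions, v != shift r`_[0] r`_[1] &
      v != shift (shift r`_[0] r`_[1]) origin].
    exists ((shift r`_[0] r`_[1]).2, (shift r`_[0] r`_[1]).1).
    by move: hu; rewrite !inE => /or4P[] /eqP ->.
  case/and3P: hv => hv1 hv2 hv3.
  have [g [hb hg _]] := frame_exists r`_[0] hu hv1 hv2 hv3.
  exists g => //; rewrite hg; elim=> // i IH hi; rewrite -(IH (ltnW hi)); apply/eqP.
  by have := hk i.+1 (ltnW hi); rewrite /state hi /turn /=; case: (_ == _).
move=> ks kt; have [g gb gd] := framed s hs h3 ks.
rewrite hst in h3; have [h hb hd] := framed t ht h3 kt.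
by apply: (same_walk_iso (d := fun=> step_x) hst _ gb hb gd hd); rewrite hst; lia.
Qed.

Lemma zigzag_iso s t : cell_chain s -> cell_chain t -> size s = size t -> (2 < size s)%N ->
  (forall i, (i < size s)%N -> state s i != Some false) ->
  (forall i, (i < size t)%N -> state t i != Some false) ->
  graph_iso (cells_graph s) (cells_graph t).
Proof.
move=> hs ht hst h3.
have framed r : cell_chain r -> (2 < size r)%N ->
    (forall i, (i < size r)%N -> state r i != Some false) ->
    exists2 g, base g = r`_[0] &
      forall i, (i.+1 < size r)%N ->
        shift r`_[i] r`_[i.+1] = rotate g (if odd i then step_y else step_x).
  move=> hr hr3 hk; have hu := step_direction hr (ltnW hr3); have hv := step_direction hr hr3.
  have kt i : (i.+2 < size r)%N -> turn r i.+1.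
    by move=> hi; have := hk i.+1 (ltnW hi); rewrite /state hi /=; case: (turn _ _).
  have [g [hb hg1 hg2]] := frame_exists r`_[0] hu hv (kt 0%N hr3) (no_backtrack hr hr3).
  exists g => // i; elim/ltn_ind: i => -[|[|i]] IH hi //=.
  have hi1 := ltnW hi; have hi2 := ltnW hi1.
  rewrite negbK -(IH i (leqW (leqnn _)) hi2).
  have := zigzag_directions => /allP/(_ _ (step_direction hr hi2)).
  move=> /allP/(_ _ (step_direction hr hi1)) /allP/(_ _ (step_direction hr hi)).
  have k1 : shift r`_[i.+1] r`_[i.+2] != shift r`_[i] r`_[i.+1] := kt i hi1.
  have k2 : shift r`_[i.+2] r`_[i.+3] != shift r`_[i.+1] r`_[i.+2] := kt i.+1 hi.
  move/implyP => h; apply/eqP/h; rewrite k1 k2 !no_backtrack // !andTb.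
  rewrite (_ : adjacent _ _ = adjacent r`_[i] r`_[i.+3]).
    case: hr => _ -> //; last exact: ltnW.
    by lia.
  rewrite -[RHS](shift_adjacent r`_[i]) /shift !subrr /place /=.
  by congr (adjacent _ (_, _)); rewrite !addrA !subrK.
move=> ks kt; have [g gb gd] := framed s hs h3 ks.
rewrite hst in h3; have [h hb hd] := framed t ht h3 kt.
by apply: (same_walk_iso hst _ gb hb gd hd); rewrite hst; lia.
Qed.

(** * Comparison with the linear and the zigzag chain *)

Definition all_kinks (x : option bool) : option bool := omap (fun=> true) x.
Definition no_kink (x : option bool) : option bool := omap (fun=> false) x.

Lemma state_None n (B : polyomino_chain n) i :
  (state (squares B) i == None) = ~~ ((0 < i)%N && (i.+1 < n)%N).
Proof. by rewrite /state size_squares; case: ifP. Qed.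

Lemma joint_states n (B : polyomino_chain n) i : (2 < n)%N -> (i.+1 < n)%N ->
  (state (squares B) i == None) && (state (squares B) i.+1 == None) = false.
Proof. by rewrite !state_None; lia. Qed.

Lemma linear_states n (L : polyomino_chain n) i : is_linear_chain L -> (i < n)%N ->
  ~~ kinked (state (squares L) i).
Proof.
rewrite -{2}(size_squares L) => /allP hL hi.
rewrite -kink_nth //; last exact: squares_cell_chain.
by rewrite -chain_graphE; apply/hL/mem_nth.
Qed.

Lemma zigzag_states n (Z : polyomino_chain n) i : is_zigzag_chain Z -> (2 < n)%N ->
  (i < n)%N -> state (squares Z) i != Some false.
Proof.
rewrite -{2 3}(size_squares Z) => /allP hZ n3 hi; have hs := squares_cell_chain Z.
have := hZ _ (mem_nth (0, 0) hi); rewrite chain_graphE kink_nth // terminal_nth //.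
by case: (state _ _) => [[]|].
Qed.

Lemma no_kink_state n (L B : polyomino_chain n) i : is_linear_chain L -> (i < n)%N ->
  state (squares L) i = no_kink (state (squares B) i).
Proof.
move=> hL hi; have := linear_states hL hi; have := state_None L i; rewrite -(state_None B).
by case: (state (squares B) i) => [[]|]; case: (state (squares L) i) => [[]|].
Qed.

Lemma all_kinks_state n (Z B : polyomino_chain n) i : is_zigzag_chain Z -> (2 < n)%N ->
  (i < n)%N -> state (squares Z) i = all_kinks (state (squares B) i).
Proof.
move=> hZ n3 hi; have := zigzag_states hZ n3 hi; have := state_None Z i.
rewrite -(state_None B).
by case: (state (squares B) i) => [[]|]; case: (state (squares Z) i) => [[]|].
Qed.

Lemma linear_no_same_side n (L : polyomino_chain n) i : is_linear_chain L -> (i < n)%N ->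
  ~~ same_side_kinks (window_at (squares L) i).
Proof.
move=> hL hi; apply: contraL (linear_states hL (leq_ltn_trans (leq_pred i) hi)) => /and4P[kl _ _ _].
have hi' : (i < size (squares L))%N by rewrite size_squares.
have [w1 _ _] := window_at_sizes hi'.
by rewrite negbK state_left // -w1; case: (window_at _ _).1 kl.
Qed.

Lemma zigzag_no_same_side n (Z : polyomino_chain n) i : is_zigzag_chain Z -> (2 < n)%N ->
  (i < n)%N -> ~~ same_side_kinks (window_at (squares Z) i).
Proof.
move=> hZ n3 hi; apply: contra (zigzag_states hZ n3 hi) => /and4P[_ st _ _].
by rewrite state_window // size_squares.
Qed.

Section Compare.
Variables (R : realType) (f : nat -> nat -> R).
Hypothesis f_sym : forall a b, f a b = f b a.
Hypotheses (T1 : 0 < Theta1 f) (T2 : 0 < Theta1 f + 2 * Theta2 f)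
  (T3 : 0 < Theta1 f + 2 * Theta3 f).

(** The three positive combinations of the Thetas are twice the increments of
    [joint_weight] when an S becomes a K beside an S, a T or a K. *)
Lemma joint_weight_min x y : (x == None) && (y == None) = false ->
  joint_weight f (no_kink x) (no_kink y) <= joint_weight f x y
    ?= iff (~~ kinked x && ~~ kinked y).
Proof.
move: T1 T2 T3; rewrite /Theta1 /Theta2 /Theta3 => t1 t2 t3.
case: x => [[]|]; case: y => [[]|] //= _; apply/leifP;
 rewrite /joint_weight /joint /ends /= /weight /= ?big_cons ?big_nil /=; try done; 
 rewrite /minn /maxn /=; lra.
Qed.

Lemma joint_weight_max x y : (x == None) && (y == None) = false ->
  joint_weight f x y <= joint_weight f (all_kinks x) (all_kinks y)
    ?= iff ((x != Some false) && (y != Some false)).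
Proof.
move: T1 T2 T3; rewrite /Theta1 /Theta2 /Theta3 => t1 t2 t3.
case: x => [[]|]; case: y => [[]|] //= _; apply/leifP;
 rewrite /joint_weight /joint /ends /= /weight /= ?big_cons ?big_nil /=; try done; 
 rewrite /minn /maxn /=; lra.
Qed.

Lemma TI_chain n (B : polyomino_chain n) : (2 < n)%N ->
  (forall i, (i < n)%N -> ~~ same_side_kinks (window_at (squares B) i)) ->
  TI f B = \sum_(i < n.-1) joint_weight f (state (squares B) i) (state (squares B) i.+1).
Proof.
move=> n3 hB; rewrite chain_graphE TI_cells_graph ?size_squares // ?big_mkord //.
exact: squares_cell_chain.
Qed.

Variables (n : nat) (B : polyomino_chain n).
Hypotheses (n3 : (2 < n)%N) (B_Omega : Omega B).

Lemma all_pairs (P : nat -> bool) :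
  reflect (forall i, (i < n)%N -> P i) [forall i : 'I_n.-1, P i && P i.+1].
Proof.
apply: (iffP forallP) => [h i hi|h i]; last by rewrite !h //; case: i => i /=; lia.
have h0 : (i.-1 < n.-1)%N by lia.
have /andP[h1 h2] := h (Ordinal h0); case: i hi h0 h1 h2 => [|i] hi h0 h1 h2 //=.
Qed.

Lemma TI_linear_min (L : polyomino_chain n) : is_linear_chain L ->
  TI f L <= TI f B ?= iff [forall i : 'I_n.-1,
    ~~ kinked (state (squares B) i) && ~~ kinked (state (squares B) i.+1)].
Proof.
move=> hL; rewrite !TI_chain //; first last.
- by move=> i; apply: linear_no_same_side.
- by move=> i; apply: Omega_no_same_side.
apply: leif_sum => i _; have hi : (i.+1 < n)%N by case: i => i /=; lia.
rewrite !(no_kink_state B hL) // ?(ltnW hi) //; apply: joint_weight_min.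
exact: joint_states.
Qed.

Lemma TI_zigzag_max (Z : polyomino_chain n) : is_zigzag_chain Z ->
  TI f B <= TI f Z ?= iff [forall i : 'I_n.-1,
    (state (squares B) i != Some false) && (state (squares B) i.+1 != Some false)].
Proof.
move=> hZ; rewrite !TI_chain //; first last.
- by move=> i; apply: Omega_no_same_side.
- by move=> i; apply: zigzag_no_same_side.
apply: leif_sum => i _; have hi : (i.+1 < n)%N by case: i => i /=; lia.
rewrite !(all_kinks_state B hZ) // ?(ltnW hi) //; apply: joint_weight_max.
exact: joint_states.
Qed.

Lemma TI_extremal (L Z : polyomino_chain n) : is_linear_chain L -> is_zigzag_chain Z ->
  [/\ TI f L <= TI f B, TI f B <= TI f Z,
       TI f B = TI f Z <-> graph_iso B Z & TI f L = TI f B <-> graph_iso B L].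
Proof.
move=> hL hZ; have [leL eqL] := TI_linear_min hL; have [leZ eqZ] := TI_zigzag_max hZ.
have hc := squares_cell_chain; split=> //.
  split=> [/eqP|]; last exact: TI_iso.
  rewrite eqZ => /(all_pairs (fun i => state (squares B) i != Some false)) hB.
  rewrite !chain_graphE; apply: zigzag_iso; rewrite ?size_squares // => i hi.
  by apply: zigzag_states.
split=> [/eqP|/(TI_iso f_sym)] //.
rewrite eqL => /(all_pairs (fun i => ~~ kinked (state (squares B) i))) hB.
rewrite !chain_graphE; apply: straight_iso; rewrite ?size_squares // => i hi.
exact: linear_states.
Qed.
End Compare.

Theorem theorem2p12 (R : realType) (f : nat -> nat -> R)
    (f_sym : forall a b, f a b = f b a) (f_ge0 : forall a b, 0 <= f a b)
    (n : nat) (n_ge3 : (3 <= n)%N)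
    (L Z B : polyomino_chain n)
    (L_linear : is_linear_chain L) (Z_zigzag : is_zigzag_chain Z)
    (B_Omega : Omega B) :
  (0 < Theta1 f -> 0 < Theta1 f + 2 * Theta2 f ->
   0 < Theta1 f + 2 * Theta3 f ->
   [/\ TI f L <= TI f B, TI f B <= TI f Z,
       TI f B = TI f Z <-> graph_iso B Z &
       TI f L = TI f B <-> graph_iso B L]) /\
  (Theta1 f < 0 -> Theta1 f + 2 * Theta2 f < 0 ->
   Theta1 f + 2 * Theta3 f < 0 ->
   [/\ TI f Z <= TI f B, TI f B <= TI f L,
       TI f B = TI f L <-> graph_iso B L &
       TI f Z = TI f B <-> graph_iso B Z]).
Proof.
split=> [t1 t2 t3|]; first exact: TI_extremal.
rewrite /Theta1 /Theta2 /Theta3 => t1 t2 t3.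
pose g a b := - f a b.
have TIg (G : lgraph) : TI g G = - TI f G by rewrite /TI sumrN.
have [||||leL leZ eqZ eqL] := @TI_extremal R g _ _ _ _ n B n_ge3 B_Omega L Z L_linear Z_zigzag.
- by move=> a b; rewrite /g f_sym.
- by rewrite /Theta1 /g; lra.
- by rewrite /Theta1 /Theta2 /g; lra.
- by rewrite /Theta1 /Theta3 /g; lra.
rewrite !TIg !lerN2 in leL leZ eqZ eqL.
have opp_eq (x y : R) : (- x = - y) <-> (y = x) by split=> [/oppr_inj|->].
split=> //.
- by rewrite -opp_eq.
- by rewrite -opp_eq.
Qed.
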